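(* Let $\sigma>0$, $\zeta=1/(1+\sigma)$, and for $m\ge1$ let $$c_m(\sigma)=\frac{1}{m!}\sum_{p=0}^{m-1}\genfrac{\{}{\}}{0pt}{}{p+m-1}{p}_{\ge 2}(-1)^{p+m-1}\zeta^{p+m}.$$ Put $\tau_\ast=\left|1+\sigma-\sigma\ln\sigma+i\pi\sigma\right|$ and $\theta_1=\arg(1+\sigma-\sigma\ln\sigma+i\pi\sigma)$. Then, as $m\to\infty$, $$c_m(\sigma)=\sqrt{\frac{2}{\pi\sigma}}\;\frac{\sin\left(\left(m-\tfrac12\right)\theta_1\right)}{\tau_\ast^{\,m-\frac12}\,m^{\frac32}}+o\left(\frac{1}{m^{3/2}\tau_\ast^{\,m}}\right).$$
   Context: $\genfrac{\{}{\}}{0pt}{}{n}{k}_{\ge 2}$ is the 2-associated Stirling subset number (second kind): the number of partitions of an $n$-element set into $k$ blocks each of size at least $2$ (with value $1$ for $n=k=0$). $\arg$ is the principal argument. *)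

(* Defs.v *)
From mathcomp Require Import all_boot all_order all_algebra.
From mathcomp Require Import all_classical all_reals all_analysis.
From mathcomp Require Import complex.

Set Implicit Arguments.
Unset Strict Implicit.
Unset Printing Implicit Defensive.
Import Order.TTheory GRing.Theory Num.Theory.
Import numFieldNormedType.Exports.
Import Normc.
Local Open Scope ring_scope.

(* stirling2_assoc 0 0 = 1: the empty family of blocks is the unique partition
   of the empty set. *)
Definition stirling2_assoc (n k : nat) : nat :=
  #|[set P : {set {set 'I_n}} |
      [&& finset.partition P [set: 'I_n], #|P| == k
        & [forall B in P, (2 <= #|B|)%N]]]|.

(* Principal argument, in ]-pi, pi]; [carg 0] is junk (see [cargP]). *)
Definition carg (R : realType) (z : R[i]) : R :=
  if 0 <= complex.Im z then acos (complex.Re z / normc z)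
  else - acos (complex.Re z / normc z).

Lemma cargP (R : realType) (z : R[i]) : z != 0 ->
  (- pi < carg z <= pi) /\
  z = Complex (normc z * cos (carg z)) (normc z * sin (carg z)).
Proof.
move=> z0; have n0 : 0 < normc z.
  rewrite lt_neqAle eq_sym; apply/andP; split.
    by apply: contra z0 => /eqP/eq0_normc ->.
  by case: z {z0} => a b /=; rewrite sqrtr_ge0.
have nE : normc z ^+ 2 = complex.Re z ^+ 2 + complex.Im z ^+ 2.
  by case: z {z0 n0} => a b /=; rewrite sqr_sqrtr// addr_ge0// sqr_ge0.
set t := complex.Re z / normc z.
have t2 : 1 - t ^+ 2 = (complex.Im z / normc z) ^+ 2.
  rewrite !expr_div_n -(divff (lt0r_neq0 (exprn_gt0 2 n0))) -mulrBl.
  by rewrite nE addrAC subrr add0r.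
have tI : -1 <= t <= 1.
  by rewrite -ler_norml -(expr_le1 (n:=2))// real_normK ?num_real// -subr_ge0 t2 sqr_ge0.
have st : normc z * sin (acos t) = `|complex.Im z|.
  rewrite sin_acos// t2 sqrtr_sqr normrM normfV (gtr0_norm n0).
  by rewrite mulrC divfK ?gt_eqF.
have ct : normc z * cos (acos t) = complex.Re z.
  by rewrite acosK// mulrC divfK ?gt_eqF.
rewrite /carg -/t; case: ifPn => [i0|]; last rewrite -ltNge => i0.
  split; last by rewrite ct st (ger0_norm i0); case: (z).
  by rewrite acos_lepi// (lt_le_trans _ (acos_ge0 tI))// oppr_lt0 pi_gt0.
have t1 : -1 < t.
  rewrite lt_neqAle (andP tI).1 andbT; apply/eqP => tE.
  have /eqP := t2; rewrite -tE sqrrN expr1n subrr eq_sym sqrf_eq0 mulf_eq0.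
  by rewrite invr_eq0 (gt_eqF n0) (lt_eqF i0).
split.
  rewrite ltrN2 acos_ltpi ?t1 ?(andP tI).2//=.
  by rewrite lerNl (le_trans _ (acos_ge0 tI))// oppr_le0 pi_ge0.
rewrite cosN sinN mulrN ct st (ltr0_norm i0) opprK; by case: (z).
Qed.

(* Meaningful for m >= 1, where the truncated p + m - 1 is the true one. *)
Definition coef_c (R : realType) (sigma : R) (m : nat) : R :=
  let zeta := (1 + sigma)^-1 in
  (m`!%:R)^-1 * \sum_(0 <= p < m)
    (stirling2_assoc (p + m - 1) p)%:R * (-1) ^+ (p + m - 1) * zeta ^+ (p + m).

(* Main.v *)
Require Import Defs.
From mathcomp Require Import all_boot all_order all_algebra.
From mathcomp Require Import all_classical all_reals all_analysis.
From mathcomp Require Import complex.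
From mathcomp Require Import measurable_realfun ring lra zify.

Import Order.TTheory GRing.Theory Num.Theory.
Import numFieldNormedType.Exports.
Import Normc.
Local Open Scope classical_set_scope.
Local Open Scope ring_scope.

Set Implicit Arguments.
Unset Strict Implicit.
Unset Printing Implicit Defensive.

(** Put t(y) = sigma y + 1 - exp(-y) and g(y) = exp(-y) - 1 + y, so that
    t(y) = (1 + sigma) y - g(y).  By Lagrange inversion the c_m are the Taylor
    coefficients of the inverse function of t; equivalently m c_m is the
    residue of t^(-m) at 0.  Indeed the residues of g^p y^(-n) are, up to sign
    and factorials, the associated Stirling numbers ([momentE]), and the
    negative binomial series in zeta g(y) / y expands t^(-m) in these
    functions.  As t is real on the real axis, this residue is 1/pi times the
    imaginary part of the integral of t^(-m) along any path that leads through
    the upper half-plane from a positive to a negative real number and whose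
    dilations avoid the zeros of t ([coef_cE]).

    The critical points of t nearest to 0 are -ln sigma +- i pi, and t takes
    there the values z = 1 + sigma - sigma ln sigma + i pi sigma and its
    conjugate.  The asymptotics follows from the saddle point method applied
    to a path ([steep_path]) that crosses the upper critical point in the
    direction d with d^2 = z, along which t / z increases like
    1 + sigma r^2 / 2, and on which |t| > |z| elsewhere.  The part of the path
    off the saddle is exponentially small ([off_saddle]), while near the
    saddle the integrand is compared with a Gaussian ([saddle_asym]); this
    yields sqrt (2 pi / sigma) Im (- d z^(-m)) / sqrt m, and the imaginary part
    of - d z^(-m) is tau^(1/2 - m) sin ((m - 1/2) theta).

    The only deformation of paths that is needed is the dilation of a path
    towards 0: its derivative with respect to the scaling factor is a boundary
    term, which is real because both end points are ([impath_vanish]).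

    The shape of the path depends on the sign of h0 = Re z.  If h0 > 0, the
    horizontal line through the saddle will do.  If h0 <= 0, |t| does not grow
    quadratically along that line, and the path leaves the saddle steeply to
    the upper right and along the diagonal to the lower left. *)

Local Notation Re := complex.Re.
Local Notation Im := complex.Im.
Local Notation "x %:C" := (real_complex _ x) : ring_scope.

(** * Recurrence for the associated Stirling numbers *)

Section AssociatedPartitions.
Local Open Scope nat_scope.
Variable T : finType.
Implicit Types (D B : {set T}) (P : {set {set T}}).

Definition assoc_partitions D k : {set {set {set T}}} :=
  [set P : {set {set T}} |
    [&& finset.partition P D, #|P| == k & [forall B in P, 2 <= #|B|]]].

(** Removing the block B is a bijection onto the partitions of the complement of
    B. *)
Lemma card_assoc_partitions_block D B k : B \subset D -> 2 <= #|B| ->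
  #|[set P in assoc_partitions D k.+1 | B \in P]| =
  #|assoc_partitions (D :\: B) k|.
Proof.
move=> BD B2.
have B0 : B != finset.set0 by rewrite -card_gt0 (ltn_trans _ B2).
have BnQ Q : Q \in assoc_partitions (D :\: B) k -> B \notin Q.
  rewrite inE => /and3P[/and3P[/eqP cQ _ _] _ _]; apply/negP => BQ.
  have /fintype.subsetP sB : B \subset D :\: B by rewrite -cQ; apply: (bigcup_max B).
  by have /set0Pn[x xB] := B0; have := sB _ xB; rewrite !inE xB.
have -> : [set P in assoc_partitions D k.+1 | B \in P] =
    (fun Q => B |: Q) @: assoc_partitions (D :\: B) k.
  apply/setP => P; apply/idP/imsetP => [|[Q QD ->]].
    rewrite !inE => /andP[/and3P[pP /eqP cP /forallP fP] BP].
    exists (P :\ B)%SET; last by rewrite finset.setD1K.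
    rewrite !inE partitionD1//=; apply/andP; split.
      by move: cP; rewrite (cardsD1 B) BP add1n => -[->].
    by apply/forallP => B'; apply/implyP; rewrite !inE => /andP[_ /(implyP (fP B'))].
  have BQ := BnQ _ QD; move: QD; rewrite !inE eqxx/= andbT.
  move=> /and3P[pQ /eqP cQ /forallP fQ]; apply/and3P; split.
  - have -> : D = B :|: (D :\: B).
      apply/setP => x; rewrite !inE; case: (boolP (x \in B)) => //= xB.
      by rewrite (fintype.subsetP BD).
    apply: partitionU1 => //; rewrite -finset.setI_eq0; apply/eqP/setP => x.
    by rewrite !inE; case: (x \in B).
  - by rewrite cardsU1 BQ cQ.
  - by apply/forallP => B'; apply/implyP; rewrite !inE => /orP[/eqP ->//|/(implyP (fQ B'))].
rewrite card_in_imset// => Q1 Q2 /BnQ h1 /BnQ h2 e.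
by rewrite -(finset.setU1K h1) e finset.setU1K.
Qed.

Lemma assoc_partitions_subset D k P B : P \in assoc_partitions D k ->
  B \in P -> (B \subset D) && (2 <= #|B|).
Proof.
rewrite inE => /and3P[/and3P[/eqP cQ _ _] _ /forallP fP] BP.
by rewrite (implyP (fP B))// andbT -cQ; apply: (bigcup_max B).
Qed.

(** Both sides count the pairs of a partition and one of its blocks. *)
Lemma card_assoc_partitions_mul D k :
  k.+1 * #|assoc_partitions D k.+1| =
  \sum_(B : {set T} | (B \subset D) && (2 <= #|B|))
     #|assoc_partitions (D :\: B) k|.
Proof.
transitivity (\sum_(P in assoc_partitions D k.+1)
    \sum_(B : {set T} | (B \subset D) && (2 <= #|B|)) (B \in P : nat)).
  rewrite mulnC -sum_nat_const; apply: eq_bigr => P PD.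
  rewrite -big_mkcondr/= sum1_card.
  have /eqP <- : #|P| == k.+1 by move: PD; rewrite inE => /and3P[].
  apply: eq_card => B; rewrite [RHS]unfold_in/=; apply/idP/andP => [BP|[]//].
  by split=> //; exact: assoc_partitions_subset PD BP.
rewrite exchange_big/=; apply: eq_bigr => B /andP[BD B2].
rewrite -(card_assoc_partitions_block k BD B2) -big_mkcondr sum1_card.
by apply: eq_card => P; rewrite inE.
Qed.

Lemma card_assoc_partitions_pblock D k x : x \in D ->
  #|assoc_partitions D k.+1| =
  \sum_(B : {set T} | [&& x \in B, B \subset D & 2 <= #|B|])
     #|assoc_partitions (D :\: B) k|.
Proof.
move=> xD.
transitivity (\sum_(P in assoc_partitions D k.+1)
    \sum_(B : {set T} | [&& x \in B, B \subset D & 2 <= #|B|]) (B \in P : nat)).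
  rewrite -sum1_card; apply: eq_bigr => P PD.
  have := PD; rewrite inE => /and3P[/and3P[/eqP cP tP _] _ _].
  have xP : x \in finset.cover P by rewrite cP.
  rewrite -big_mkcondr/= sum1_card -[LHS](cards1 (finset.pblock P x)).
  apply: eq_card => B; rewrite inE [RHS]unfold_in/=.
  apply/eqP/andP => [->|[/andP[xB _] BP]].
    have bP := finset.pblock_mem xP; split=> //; rewrite finset.mem_pblock xP/=.
    exact: assoc_partitions_subset PD bP.
  by rewrite (finset.def_pblock tP BP xB).
rewrite exchange_big/=; apply: eq_bigr => B /and3P[xB BD B2].
rewrite -(card_assoc_partitions_block k BD B2) -big_mkcondr sum1_card.
by apply: eq_card => P; rewrite inE.
Qed.


(** The block of x either has at least three elements, and then removing x leaves
    a partition of the rest with a distinguished block, or it is a pair. *)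
Lemma card_assoc_partitions_rec D k x : x \in D ->
  #|assoc_partitions D k.+1| = k.+1 * #|assoc_partitions (D :\ x) k.+1| +
     \sum_(y in D :\ x) #|assoc_partitions (D :\ x :\ y) k|.
Proof.
move=> xD; rewrite (card_assoc_partitions_pblock k xD).
rewrite card_assoc_partitions_mul.
rewrite (reindex_onto (fun B => x |: B)%SET (fun B => B :\ x)%SET); last first.
  by move=> B /and3P[xB _ _]; rewrite finset.setD1K.
rewrite (eq_bigl (fun B : {set T} => (B \subset D :\ x) && (0 < #|B|))); last first.
  move=> B; rewrite finset.setU11/= finset.subUset finset.sub1set xD/= cardsU1 finset.subsetD1.
  have [xB|xB] := boolP (x \in B); last first.
    by rewrite finset.setU1K// eqxx !andbT.
  rewrite andbF/=; apply/andP => -[_ /eqP /setP /(_ x)].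
  by rewrite !inE eqxx xB.
under eq_bigr do rewrite -finset.setDDl.
rewrite (bigID (fun B : {set T} => 1 < #|B|))/=; congr (_ + _).
  by apply: eq_bigl => B; lia.
have := @big_imset _ _ addn _ _ finset.set1 (mem (D :\ x))
  (fun B => #|assoc_partitions (D :\ x :\: B) k|).
move=> <-; last by move=> y z _ _ /setP/(_ y); rewrite !inE eqxx => /esym/eqP.
apply: eq_bigl => B; apply/andP/imsetP => [[/andP[BD B0] B1]|[y yD ->]].
  have /cards1P[y By] : #|B| == 1 by lia.
  by exists y => //; rewrite -finset.sub1set -By.
by rewrite finset.sub1set cards1 yD.
Qed.

Lemma card_assoc_partitions0 D k : #|D| = 0 ->
  #|assoc_partitions D k| = (k == 0).
Proof.
move=> /cards0_eq ->; have e : forall P, finset.partition P (finset.set0 : {set T}) = (P == finset.set0).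
  by move=> P; exact: partition_set0.
case: k => [|k] /=.
  rewrite -(cards1 (finset.set0 : {set {set T}})); apply: eq_card => P.
  rewrite !inE e; apply/andP/idP => [[]//|/eqP ->]; rewrite eqxx cards0 eqxx.
  by split => //; apply/andP; split=> //; apply/forallP => B; rewrite inE.
apply: eq_card0 => P; rewrite !inE e; apply/negP => /and3P[/eqP ->].
by rewrite cards0.
Qed.

Lemma card_assoc_partitions_k0 D : 0 < #|D| -> #|assoc_partitions D 0| = 0.
Proof.
move=> D0; apply: eq_card0 => P; rewrite !inE; apply/negP.
move=> /and3P[/and3P[/eqP cP _ _] + _]; rewrite cards_eq0 => /eqP P0.
by move: D0; rewrite -cP P0 /finset.cover finset.big_set0 cards0.
Qed.

End AssociatedPartitions.

(** The recurrence S(n+1, k+1) = (k+1) S(n, k+1) + n S(n-1, k). *)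
Fixpoint stirling2_assoc_rec (n k : nat) {struct n} : nat :=
  match n, k with
  | 0, 0 => 1
  | 0, _.+1 => 0
  | _.+1, 0 => 0
  | n'.+1, k'.+1 => k * stirling2_assoc_rec n' k +
      (if n' is n''.+1 then n' * stirling2_assoc_rec n'' k' else 0)
  end%N.

Lemma stirling2_assocE n k : stirling2_assoc n k = stirling2_assoc_rec n k.
Proof.
suff h (T : finType) (D : {set T}) : #|assoc_partitions D k| = stirling2_assoc_rec #|D| k.
  by rewrite -[in RHS](card_ord n) -finset.cardsT -h.
move: {2}#|D| (leqnn #|D|) => N; elim: N => [|N IH] in T D k *.
  by rewrite leqn0 => /eqP D0; rewrite card_assoc_partitions0// D0; case: k.
have [D0 _|D0 DN] := posnP #|D|.
  by rewrite card_assoc_partitions0// D0; case: k.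
case: k => [|k].
  by rewrite card_assoc_partitions_k0//; case: #|D| D0.
have [x xD] : exists x, x \in D by apply/card_gt0P.
have cD : #|D| = #|D :\ x|.+1 by rewrite (cardsD1 x) xD.
rewrite (card_assoc_partitions_rec k xD) cD/= IH; last by lia.
congr (_ + _)%N; case cDx : #|D :\ x| => [|n'].
  by move/cards0_eq: cDx => ->; rewrite finset.big_set0.
rewrite -[in RHS]cDx -sum_nat_const; apply: eq_bigr => y yD.
have cDxy : #|D :\ x :\ y| = n' by move: cDx; rewrite (cardsD1 y) yD => -[].
by rewrite IH cDxy//; lia.
Qed.

(** * Real and imaginary parts, modulus, complex exponential *)

Section ComplexArith.
Context {R : realType}.
Implicit Types z w : R[i].

Lemma cReD z w : Re (z + w) = Re z + Re w. Proof. by case: z; case: w. Qed.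
Lemma cImD z w : Im (z + w) = Im z + Im w. Proof. by case: z; case: w. Qed.
Lemma cReN z : Re (- z) = - Re z. Proof. by case: z. Qed.
Lemma cImN z : Im (- z) = - Im z. Proof. by case: z. Qed.
Lemma cReM z w : Re (z * w) = Re z * Re w - Im z * Im w.
Proof. by case: z; case: w. Qed.
Lemma cImM z w : Im (z * w) = Re z * Im w + Im z * Re w.
Proof. by case: z => a b; case: w => c d. Qed.
Lemma cReZ (x : R) z : Re (x%:C * z) = x * Re z.
Proof. by rewrite cReM mul0r subr0. Qed.
Lemma cImZ (x : R) z : Im (x%:C * z) = x * Im z.
Proof. by rewrite cImM mul0r addr0. Qed.
Lemma cReV z : Re z^-1 = Re z / (Re z ^+ 2 + Im z ^+ 2).
Proof. by case: z. Qed.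
Lemma cImV z : Im z^-1 = - (Im z / (Re z ^+ 2 + Im z ^+ 2)).
Proof. by case: z. Qed.

Lemma complexP z w : Re z = Re w -> Im z = Im w -> z = w.
Proof. by case: z => a b; case: w => c d /= -> ->. Qed.

Lemma normc_sqr z : normc z ^+ 2 = Re z ^+ 2 + Im z ^+ 2.
Proof. by case: z => a b /=; rewrite sqr_sqrtr// addr_ge0 ?sqr_ge0. Qed.

Lemma normc_ge0 z : 0 <= normc z.
Proof. by case: z => a b /=; rewrite sqrtr_ge0. Qed.

Lemma normc_gt0 z : (0 < normc z) = (z != 0).
Proof.
rewrite lt_neqAle normc_ge0 andbT eq_sym; congr (~~ _); apply/eqP/eqP.
  exact: eq0_normc.
by move=> ->; rewrite normc0.
Qed.

Lemma sqr_neq0 z : z != 0 -> Re z ^+ 2 + Im z ^+ 2 != 0.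
Proof. by rewrite -normc_gt0 -normc_sqr => z0; rewrite gt_eqF// exprn_gt0. Qed.

Lemma normcX z n : normc (z ^+ n) = normc z ^+ n.
Proof. by elim: n => [|n IH]; rewrite ?normc1// !exprS normcM IH. Qed.

Lemma normc_real (x : R) : normc x%:C = `|x|.
Proof. by rewrite /= expr0n addr0 sqrtr_sqr. Qed.

Lemma ler_Re_normc z : `|Re z| <= normc z.
Proof.
rewrite -(ler_pXn2r (n := 2)) ?nnegrE ?normc_ge0// real_normK ?num_real//.
by rewrite normc_sqr lerDl sqr_ge0.
Qed.

Lemma ler_Im_normc z : `|Im z| <= normc z.
Proof.
rewrite -(ler_pXn2r (n := 2)) ?nnegrE ?normc_ge0// real_normK ?num_real//.
by rewrite normc_sqr lerDr sqr_ge0.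
Qed.

Lemma normc_le_ReIm z : normc z <= `|Re z| + `|Im z|.
Proof.
rewrite -(ler_pXn2r (n := 2)) ?nnegrE ?normc_ge0 ?addr_ge0//.
rewrite normc_sqr sqrrD !real_normK ?num_real//.
by rewrite lerD2r lerDl mulrn_wge0 ?mulr_ge0.
Qed.

Lemma normcB_le z w : normc z - normc w <= normc (z - w).
Proof. by rewrite lerBlDr; apply: le_trans (le_normcD _ _); rewrite subrK. Qed.

Definition cexp z : R[i] :=
  Complex (expR (Re z) * cos (Im z)) (expR (Re z) * sin (Im z)).

Lemma cexp0 : cexp 0 = 1.
Proof. by rewrite /cexp /= expR0 cos0 sin0 !mul1r. Qed.

Lemma cexpD z w : cexp (z + w) = cexp z * cexp w.
Proof.
apply: complexP; rewrite ?cReM ?cImM/= cReD cImD expRD ?cosD ?sinD; ring.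
Qed.

Lemma normc_cexp z : normc (cexp z) = expR (Re z).
Proof.
rewrite /= !exprMn -mulrDr cos2Dsin2 mulr1 sqrtr_sqr ger0_norm//.
Qed.

End ComplexArith.

(** * Componentwise calculus of complex functions *)

Section ComplexCalculus.
Context {R : realType}.
Local Notation C := R[i].

(** Derivative of a complex-valued function of a real variable; [deriv_at] below
    is complex differentiability, tested along all differentiable curves, so that
    the chain rule holds by definition. *)
Definition cderiv (f : R -> C) (x : R) (l : C) :=
  is_derive x 1 (fun u => Re (f u)) (Re l) /\
  is_derive x 1 (fun u => Im (f u)) (Im l).

(** Continuity on an arbitrary topological space: the case of the plane serves to
    bound integrands on compact rectangles. *)
Definition ccont (T : topologicalType) (f : T -> C) (p : T) :=
  continuous_at p (fun u => Re (f u)) /\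
  continuous_at p (fun u => Im (f u)).

Lemma cderiv_eq f x l l' : cderiv f x l -> l = l' -> cderiv f x l'.
Proof. by move=> ? <-. Qed.

Lemma cderiv_cst c x : cderiv (fun _ => c) x 0.
Proof. by split; exact: is_derive_cst. Qed.

Lemma cderiv_real (f : R -> R) (x l : R) : is_derive x 1 f l ->
  cderiv (fun u => (f u)%:C) x l%:C.
Proof. by move=> df; split => //=; exact: is_derive_cst. Qed.

Lemma cderivD f g x l k : cderiv f x l -> cderiv g x k ->
  cderiv (fun u => f u + g u) x (l + k).
Proof.
move=> [? ?] [? ?]; split; rewrite ?cReD ?cImD; under eq_fun do rewrite ?cReD ?cImD;
  exact: is_deriveD.
Qed.

Lemma cderivN f x l : cderiv f x l -> cderiv (fun u => - f u) x (- l).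
Proof.
move=> [? ?]; split; rewrite ?cReN ?cImN; under eq_fun do rewrite ?cReN ?cImN;
  exact: is_deriveN.
Qed.

Lemma cderivM f g x l k : cderiv f x l -> cderiv g x k ->
  cderiv (fun u => f u * g u) x (l * g x + f x * k).
Proof.
move=> [? ?] [? ?]; split; rewrite ?cReD ?cImD ?cReM ?cImM;
  under eq_fun do rewrite ?cReM ?cImM; apply: is_derive_eq;
  rewrite /GRing.scale/=; ring.
Qed.

Lemma cderivV f x l : f x != 0 -> cderiv f x l ->
  cderiv (fun u => (f u)^-1) x (- (l * (f x)^-1 ^+ 2)).
Proof.
move=> /sqr_neq0 fx0 [? ?].
have dn : is_derive x 1 (fun u => (Re (f u) ^+ 2 + Im (f u) ^+ 2)^-1)
   (- (Re (f x) ^+ 2 + Im (f x) ^+ 2) ^- 2 *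
    (2 * Re (f x) * Re l + 2 * Im (f x) * Im l)).
  have d2 : is_derive x 1 (fun u => (Re (f u) ^+ 2 + Im (f u) ^+ 2))
    (2 * Re (f x) * Re l + 2 * Im (f x) * Im l).
    by apply: is_derive_eq; rewrite /GRing.scale/=; ring.
  exact: (@is_deriveV _ (fun u => Re (f u) ^+ 2 + Im (f u) ^+ 2) x _ 1 fx0 d2).
split; under eq_fun do rewrite ?cReV ?cImV; apply: is_derive_eq;
  rewrite /GRing.scale/= ?cReN ?cImN ?cReM ?cImM expr2 ?cReM ?cImM ?cReV ?cImV;
  by field.
Qed.

Lemma cderiv_exp f x l : cderiv f x l ->
  cderiv (fun u => cexp (f u)) x (l * cexp (f x)).
Proof.
move=> [dR dI].
have dE : is_derive x 1 (fun u => expR (Re (f u))) (expR (Re (f x)) * Re l).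
  exact: (@is_derive1_comp _ expR).
have dc : is_derive x 1 (fun u => cos (Im (f u))) (- sin (Im (f x)) * Im l).
  exact: (@is_derive1_comp _ cos).
have ds : is_derive x 1 (fun u => sin (Im (f u))) (cos (Im (f x)) * Im l).
  exact: (@is_derive1_comp _ sin).
split; rewrite ?cReM ?cImM /=; apply: is_derive_eq; rewrite /GRing.scale/=; ring.
Qed.

Lemma ccont_cst (T : topologicalType) c (p : T) : ccont (fun _ => c) p.
Proof. by split; exact: cst_continuous. Qed.

Lemma ccont_real (T : topologicalType) (f : T -> R) (p : T) :
  continuous_at p f -> ccont (fun u => (f u)%:C) p.
Proof. by move=> cf; split => //=; exact: cst_continuous. Qed.

Lemma ccontD (T : topologicalType) (f g : T -> C) p : ccont f p -> ccont g p ->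
  ccont (fun u => f u + g u) p.
Proof.
move=> [? ?] [? ?]; split; under eq_fun do rewrite ?cReD ?cImD;
  exact: continuousD.
Qed.

Lemma ccontN (T : topologicalType) (f : T -> C) p : ccont f p ->
  ccont (fun u => - f u) p.
Proof.
move=> [? ?]; split; under eq_fun do rewrite ?cReN ?cImN; exact: continuousN.
Qed.

Lemma ccontM (T : topologicalType) (f g : T -> C) p : ccont f p -> ccont g p ->
  ccont (fun u => f u * g u) p.
Proof.
move=> [? ?] [? ?]; split; under eq_fun do rewrite ?cReM ?cImM.
  by apply: cvgB; apply: cvgM.
by apply: cvgD; apply: cvgM.
Qed.

Lemma ccontV (T : topologicalType) (f : T -> C) p : f p != 0 -> ccont f p ->
  ccont (fun u => (f u)^-1) p.
Proof.
move=> /sqr_neq0 fp0 [cR cI].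
have cn : continuous_at p (fun u => (Re (f u) ^+ 2 + Im (f u) ^+ 2)^-1).
  by apply: cvgV => //; apply: cvgD; apply: cvgM.
split; under eq_fun do rewrite ?cReV ?cImV; first by apply: cvgM.
by apply: cvgN; apply: cvgM.
Qed.

Lemma ccont_exp (T : topologicalType) (f : T -> C) p : ccont f p ->
  ccont (fun u => cexp (f u)) p.
Proof.
move=> [cR cI]; split => /=; apply: cvgM.
- exact: (continuous_comp cR (@continuous_expR _ _)).
- exact: (continuous_comp cI (@continuous_cos _ _)).
- exact: (continuous_comp cR (@continuous_expR _ _)).
- exact: (continuous_comp cI (@continuous_sin _ _)).
Qed.

Lemma cderiv_ccont f x l : cderiv f x l -> ccont f x.
Proof.
by move=> [[? _] [? _]]; split; apply: differentiable_continuous;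
  exact/derivable1_diffP.
Qed.

Lemma continuous_normc_sqr (T : topologicalType) (f : T -> C) p : ccont f p ->
  continuous_at p (fun u => normc (f u) ^+ 2).
Proof.
move=> [cR cI]; under eq_fun do rewrite normc_sqr.
by apply: cvgD; apply: cvgM.
Qed.

Definition cont_at (F : C -> C) z :=
  forall (T : topologicalType) (f : T -> C) p, f p = z -> ccont f p ->
    ccont (fun u => F (f u)) p.

Definition deriv_at (F dF : C -> C) z :=
  forall (f : R -> C) x l, f x = z -> cderiv f x l ->
    cderiv (fun u => F (f u)) x (dF z * l).

(** [dF] is the complex derivative of [F] on [D], and both are continuous there. *)
Definition holo (D : C -> Prop) (F dF : C -> C) :=
  forall z, D z -> [/\ deriv_at F dF z, cont_at F z & cont_at dF z].

Lemma holo_cst D c : holo D (fun _ => c) (fun _ => 0).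
Proof.
move=> z _; split.
- by move=> f x l _ _; rewrite mul0r; exact: cderiv_cst.
- by move=> T f p _ _; exact: ccont_cst.
- by move=> T f p _ _; exact: ccont_cst.
Qed.

Lemma holo_id D : holo D id (fun _ => 1).
Proof.
move=> z _; split.
- by move=> f x l _; rewrite mul1r.
- by move=> T f p _.
- by move=> T f p _ _; exact: ccont_cst.
Qed.

Lemma holoD D F G dF dG : holo D F dF -> holo D G dG ->
  holo D (fun z => F z + G z) (fun z => dF z + dG z).
Proof.
move=> hF hG z Dz; have [dFz cF cdF] := hF z Dz; have [dGz cG cdG] := hG z Dz.
split.
- move=> f x l fx dl; rewrite mulrDl.
  by apply: cderivD; [exact: dFz|exact: dGz].
- by move=> T f p fp cf; apply: ccontD; [exact: cF|exact: cG].
- by move=> T f p fp cf; apply: ccontD; [exact: cdF|exact: cdG].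
Qed.

Lemma holoN D F dF : holo D F dF -> holo D (fun z => - F z) (fun z => - dF z).
Proof.
move=> hF z Dz; have [dFz cF cdF] := hF z Dz; split.
- by move=> f x l fx dl; rewrite mulNr; apply: cderivN; exact: dFz.
- by move=> T f p fp cf; apply: ccontN; exact: cF.
- by move=> T f p fp cf; apply: ccontN; exact: cdF.
Qed.

Lemma holoM D F G dF dG : holo D F dF -> holo D G dG ->
  holo D (fun z => F z * G z) (fun z => dF z * G z + F z * dG z).
Proof.
move=> hF hG z Dz; have [dFz cF cdF] := hF z Dz; have [dGz cG cdG] := hG z Dz.
split.
- move=> f x l fx dl; apply: (cderiv_eq (cderivM (dFz _ _ _ fx dl) (dGz _ _ _ fx dl))).
  by rewrite fx; ring.
- by move=> T f p fp cf; apply: ccontM; [exact: cF|exact: cG].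
- move=> T f p fp cf; apply: ccontD; apply: ccontM;
    by [exact: cdF|exact: cG|exact: cF|exact: cdG].
Qed.

Lemma holoV D F dF : (forall z, D z -> F z != 0) -> holo D F dF ->
  holo D (fun z => (F z)^-1) (fun z => - (dF z * ((F z)^-1 * (F z)^-1))).
Proof.
move=> F0 hF z Dz; have [dFz cF cdF] := hF z Dz; split.
- move=> f x l fx dl; apply: (cderiv_eq (cderivV _ (dFz _ _ _ fx dl))).
    by rewrite fx; exact: F0.
  by rewrite fx; ring.
- by move=> T f p fp cf; apply: ccontV; [rewrite fp; exact: F0|exact: cF].
- move=> T f p fp cf; apply: ccontN; apply: ccontM; first exact: cdF.
  by apply: ccontM; (apply: ccontV; [rewrite fp; exact: F0|exact: cF]).
Qed.

Lemma holo_exp D F dF : holo D F dF ->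
  holo D (fun z => cexp (F z)) (fun z => dF z * cexp (F z)).
Proof.
move=> hF z Dz; have [dFz cF cdF] := hF z Dz; split.
- move=> f x l fx dl; apply: (cderiv_eq (cderiv_exp (dFz _ _ _ fx dl))).
  by rewrite fx; ring.
- by move=> T f p fp cf; apply: ccont_exp; exact: cF.
- by move=> T f p fp cf; apply: ccontM; [exact: cdF|apply: ccont_exp; exact: cF].
Qed.

Lemma holoX D F dF n : holo D F dF ->
  exists dG, holo D (fun z => F z ^+ n) dG /\
    (forall z, D z -> dG z = n%:R * F z ^+ n.-1 * dF z).
Proof.
move=> hF; elim: n => [|n [dG [hG eG]]].
  by exists (fun _ => 0); split; [exact: holo_cst|move=> z _; rewrite !mul0r].
exists (fun z => dF z * F z ^+ n + F z * dG z); split.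
  by have := holoM hF hG; under eq_fun do rewrite -exprS.
move=> z Dz; rewrite eG//; case: n {hG eG} => [|n]/=.
  by rewrite !expr0; ring.
by rewrite !exprS -[n.+2]addn1 -[n.+1]addn1 !natrD; ring.
Qed.

End ComplexCalculus.

(** * Integrals of continuous functions over the unit interval *)

Section UnitInterval.
Context {R : realType}.
Local Notation mu := (@lebesgue_measure R).
Implicit Types f g : R -> R.

Definition I01 f := \int[mu]_(x in `[0, 1]) f x.

Definition cont01 f := forall x : R, x \in `[0, 1] -> continuous_at x f.

Lemma cont01_within f : cont01 f -> {within `[0, 1], continuous f}.
Proof. by move=> cf; apply: continuous_in_subspaceT => x /set_mem; exact: cf. Qed.

Lemma cont01_integrable f : cont01 f -> mu.-integrable `[0, 1] (EFin \o f).
Proof.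
move=> /cont01_within; apply: continuous_compact_integrable.
exact: segment_compact.
Qed.

Lemma cont01_cst c : cont01 (fun _ => c). Proof. by move=> x _; exact: cvg_cst. Qed.

Lemma I01_eq f g : (forall x : R, x \in `[0, 1] -> f x = g x) -> I01 f = I01 g.
Proof. by move=> fg; apply: eq_Rintegral => x /set_mem; exact: fg. Qed.

Lemma I01D f g : cont01 f -> cont01 g -> I01 (fun x => f x + g x) = I01 f + I01 g.
Proof. by move=> cf cg; apply: RintegralD => //; exact: cont01_integrable. Qed.

Lemma I01B f g : cont01 f -> cont01 g -> I01 (fun x => f x - g x) = I01 f - I01 g.
Proof. by move=> cf cg; apply: RintegralB => //; exact: cont01_integrable. Qed.

Lemma I01Z c f : cont01 f -> I01 (fun x => c * f x) = c * I01 f.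
Proof. by move=> cf; apply: RintegralZl => //; exact: cont01_integrable. Qed.

Lemma I01_cst c : I01 (fun _ => c) = c.
Proof.
rewrite /I01 Rintegral_cst//= lebesgue_measure_itv/= lte_fin ltr01 -EFinB/=.
by rewrite subr0 mulr1.
Qed.

Lemma le_I01 f g : cont01 f -> cont01 g ->
  (forall x : R, x \in `[0, 1] -> f x <= g x) -> I01 f <= I01 g.
Proof. by move=> cf cg fg; apply: le_Rintegral => //; exact: cont01_integrable. Qed.

Lemma I01_norm_le f g : cont01 f -> cont01 g ->
  (forall x : R, x \in `[0, 1] -> `|f x| <= g x) -> `|I01 f| <= I01 g.
Proof.
move=> cf cg fg; rewrite ler_norml; apply/andP; split.
  rewrite -mulN1r -I01Z//; apply: le_I01 => //.
    by move=> x x01; apply: cvgM; [exact: cvg_cst|exact: cg].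
  by move=> x /fg; rewrite ler_norml mulN1r => /andP[].
by apply: le_I01 => // x /fg; rewrite ler_norml => /andP[].
Qed.

Lemma I01_FTC (F f : R -> R) : cont01 f ->
  (forall x : R, x \in `[0, 1] -> is_derive x 1 F (f x)) -> I01 f = F 1 - F 0.
Proof.
move=> cf dF; rewrite /I01 /Rintegral (@continuous_FTC2 _ f F) ?ltr01//.
- exact: cont01_within.
- have cF (x : R) : x \in `[0, 1] -> continuous_at x F.
    by move=> /dF[+ _] => /derivable1_diffP; exact: differentiable_continuous.
  split.
  + by move=> x /subset_itv_oo_cc/dF[].
  + by apply: cvg_at_right_filter; apply: cF; rewrite in_itv/= lexx ler01.
  + by apply: cvg_at_left_filter; apply: cF; rewrite in_itv/= lexx ler01.
- by move=> x /subset_itv_oo_cc/dF[_ <-]; rewrite derive1E.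
Qed.

(** Differentiation under the integral sign, for a dominating constant. *)
Lemma I01_derive (f df : R -> R -> R) (s0 u v M : R) : s0 \in `]u, v[ ->
  (forall s : R, s \in `]u, v[ -> cont01 (f s)) ->
  (forall s x : R, s \in `]u, v[ -> x \in `[0, 1] ->
     is_derive s 1 (f^~ x) (df s x) /\ `|df s x| <= M) ->
  is_derive s0 1 (fun s => I01 (f s)) (I01 (df s0)).
Proof.
move=> s0uv cf dfP.
have M0 : 0 <= M.
  by have [|_] := @dfP s0 0 s0uv; rewrite ?in_itv/= ?lexx ?ler01//; apply: le_trans.
have H := (@derivable_under_integral R _ _ mu f `[0, 1] _ s0 u v s0uv _ _ (fun _ => M) _ _ _).
have H' := (@differentiation_under_integral R _ _ mu f `[0, 1] _ s0 u v s0uv _ _ (fun _ => M) _ _ _).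
have i1 : measurable (`[0, 1] : set R) by [].
have i2 : forall x : R, `]u, v[%classic x -> mu.-integrable `[0, 1] (EFin \o f x).
  by move=> x xuv; apply/cont01_integrable/cf.
have i3 : forall x y : R, `]u, v[%classic x -> `[0, 1]%classic y -> derivable (f^~ y) x 1.
  by move=> x y xuv y01; have [[]] := dfP x y xuv y01.
have i4 : mu.-integrable `[0, 1] (EFin \o (fun _ => M)).
  exact: (cont01_integrable (@cont01_cst M)).
have i5 : forall x y : R, `]u, v[%classic x -> `[0, 1]%classic y -> `|partial1of2 f x y| <= M.
  move=> x y xuv y01; have [[dd de] le] := dfP x y xuv y01.
  by rewrite partial1of2E de.
apply: DeriveDef; first exact: (H i1 i2 i3 (fun=> M0) i4 i5).
rewrite -derive1E (H' i1 i2 i3 (fun=> M0) i4 i5).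
apply: I01_eq => x x01; have [[_ <-] _] := dfP s0 x s0uv x01.
by rewrite -partial1of2E.
Qed.

Lemma derive0_const (f : R -> R) (a b : R) : a <= b ->
  (forall x : R, x \in `[a, b] -> is_derive x 1 f 0) -> f a = f b.
Proof.
rewrite le_eqVlt => /predU1P[->//|ab df].
have df' x : x \in `]a, b[ -> is_derive x 1 f 0.
  by move=> /subset_itv_oo_cc/df.
have cf : {within `[a, b], continuous f}.
  apply: continuous_in_subspaceT => x /set_mem/df[+ _] => /derivable1_diffP.
  exact: differentiable_continuous.
have [c _] := @MVT R f (fun=> 0) a b ab df' cf.
by rewrite mul0r => /eqP; rewrite subr_eq0 => /eqP ->.
Qed.

End UnitInterval.

(** * Imaginary parts of integrals along segments and polygonal paths *)

Section Segments.
Context {R : realType}.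
Local Notation C := R[i].
Implicit Types (F dF : C -> C) (p q : C) (D : C -> Prop).

Definition seg p q (x : R) : C := p + x%:C * (q - p).

(** Only the imaginary part of an integral along a segment is ever needed. *)
Definition imint F p q := I01 (fun x => Im (F (seg p q x) * (q - p))).

Definition onseg D p q := forall x : R, x \in `[0, 1] -> D (seg p q x).

(** The triangle with apex 0 (excluded) over the segment from p to q. *)
Definition sweep D p q := forall s x : R, 0 < s <= 1 -> x \in `[0, 1] ->
  D (s%:C * seg p q x).

(** An open condition, tested on continuous families. *)
Definition copen D := forall (T : topologicalType) (f : T -> C) u,
  ccont f u -> D (f u) -> \forall v \near u, D (f v).

Lemma seg0 p q : seg p q 0 = p. Proof. by rewrite /seg mul0r addr0. Qed.

Lemma seg1 p q : seg p q 1 = q. Proof. by rewrite /seg mul1r addrC subrK. Qed.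

Lemma segZ s p q x : seg (s * p) (s * q) x = s * seg p q x.
Proof. by rewrite /seg; ring. Qed.

Lemma sweep_onseg D p q : sweep D p q -> onseg D p q.
Proof.
move=> h x x01; have := h 1 x; rewrite ltr01 lexx => /(_ isT x01).
by rewrite mul1r.
Qed.

Lemma cderiv_seg p q (x : R) : cderiv (seg p q) x (q - p).
Proof.
apply: (cderiv_eq (cderivD (cderiv_cst p x) (cderivM (cderiv_real
  (@is_derive_id _ _ x (1 : R))) (cderiv_cst (q - p) x)))).
by rewrite mulr0 addr0 add0r mul1r.
Qed.

Lemma ccont_seg p q (x : R) : ccont (seg p q) x.
Proof. exact: cderiv_ccont (cderiv_seg p q x). Qed.

Lemma cont_at_seg F p q : onseg (cont_at F) p q ->
  forall c, cont01 (fun x => Im (F (seg p q x) * c)).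
Proof.
move=> h c x x01; apply: (proj2 (ccontM _ (ccont_cst c x))).
by apply: (h x x01) => //; exact: ccont_seg.
Qed.

Lemma imint_FTC D F dF p q : holo D F dF -> onseg D p q ->
  imint dF p q = Im (F q) - Im (F p).
Proof.
move=> hF pq; have cf : cont01 (fun x => Im (dF (seg p q x) * (q - p))).
  by apply: cont_at_seg => x x01; have [] := hF _ (pq x x01).
rewrite -[in RHS](seg1 p q) -[in X in _ - X](seg0 p q).
apply: (I01_FTC (F := fun x => Im (F (seg p q x))) cf).
move=> x x01; have [dFx _ _] := hF _ (pq x x01).
by have [] := dFx _ _ _ erefl (cderiv_seg p q x).
Qed.

(** Compactness of the segment makes the neighbourhood of s0 uniform. *)
Lemma near_sweep D p q (s0 : R) : copen D -> 
  onseg (fun z => D (s0%:C * z)) p q ->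
  \forall s \near s0, onseg (fun z => D (s%:C * z)) p q.
Proof.
move=> oD h.
have /compact_near_coveringP := @segment_compact R 0 1.
move=> /(_ _ (nbhs s0) (fun s x => D (s%:C * seg p q x)) _); apply.
move=> x x01.
have := oD _ (fun w : R * R => w.2%:C * seg p q w.1) (x, s0); apply; last exact: h.
apply: ccontM.
  by apply: ccont_real; exact: cvg_snd.
apply: ccontD; first exact: ccont_cst.
apply: ccontM; last exact: ccont_cst.
by apply: ccont_real; exact: cvg_fst.
Qed.

(** With z = s (p + x (q - p)), the s-derivative of F(z) s (q - p) equals the
    x-derivative of F(z) (p + x (q - p)), so that the integral telescopes. *)
Lemma imint_scale_derive D F dF p q (s0 : R) : copen D -> holo D F dF ->
  onseg (fun z => D (s0%:C * z)) p q ->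
  is_derive s0 1 (fun s : R => imint F (s%:C * p) (s%:C * q))
    (Im (F (s0%:C * q) * q) - Im (F (s0%:C * p) * p)).
Proof.
move=> oD hF h.
have /nbhs_ballP[e /= e0 he] := near_sweep oD h.
pose f (s x : R) := Im (F (s%:C * seg p q x) * (s%:C * (q - p))).
pose df (s x : R) := Im (dF (s%:C * seg p q x) * seg p q x * (s%:C * (q - p)) +
  F (s%:C * seg p q x) * (q - p)).
(* Half the radius, so that the closed interval stays inside the ball. *)
pose d := e / 2; have d0 : 0 < d by rewrite divr_gt0.
have hd s x : s \in `[s0 - d, s0 + d] -> x \in `[0, 1] -> D (s%:C * seg p q x).
  move=> sd x01; apply: he => //; rewrite /ball/=.
  move: sd; rewrite in_itv/= => /andP[s1 s2]; rewrite ltr_norml.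
  by move: s1 s2; rewrite /d => s1 s2; apply/andP; split; lra.
(* The domination constant is a maximum over a compact rectangle. *)
have [M hM] : exists M, forall s x, s \in `[s0 - d, s0 + d] -> x \in `[0, 1] ->
    `|df s x| <= M.
  pose A : set (R * R) := `[s0 - d, s0 + d] `*` `[0, 1].
  have cA : compact A by apply: compact_setX; exact: segment_compact.
  have A0 : A !=set0.
    by exists (s0, 0); split; rewrite /= in_itv/= ?lexx ?ler01//; apply/andP; split; lra.
  have [|c cA' hc] := @compact_EVT_max _ R (fun w : R * R => `|df w.1 w.2|) A A0 cA.
    apply: continuous_in_subspaceT => w /set_mem[w1 w2].
    have [_ cF cdF] := hF _ (hd _ _ w1 w2).
    have cs : ccont (fun w : R * R => w.1%:C) w.
      by apply: ccont_real; exact: cvg_fst.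
    have cx : ccont (fun w : R * R => seg p q w.2) w.
      apply: ccontD; first exact: ccont_cst.
      apply: ccontM; last exact: ccont_cst.
      by apply: ccont_real; exact: cvg_snd.
    have csx := ccontM cs cx.
    apply: cvg_norm; apply: (proj2 (ccontD (ccontM (ccontM _ cx)
      (ccontM cs (ccont_cst (q - p) w))) (ccontM _ (ccont_cst (q - p) w)))).
      exact: (cdF _ _ _ _ csx).
    exact: (cF _ _ _ _ csx).
  exists `|df c.1 c.2| => s x hs hx; apply: (hc (s, x)).
  by apply/mem_set; split.
have dseg s x : s \in `[s0 - d, s0 + d] -> x \in `[0, 1] ->
    is_derive s 1 (f^~ x) (df s x).
  move=> hs hx; have [dFx _ _] := hF _ (hd _ _ hs hx).
  have ds := cderiv_real (@is_derive_id _ _ s (1 : R)).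
  have dz := cderivM ds (cderiv_cst (seg p q x) s).
  have [_] := cderivM (dFx _ _ _ erefl dz) (cderivM ds (cderiv_cst (q - p) s)).
  by congr is_derive; congr Im; rewrite /=; ring.
have sI : s0 \in `]s0 - d, s0 + d[ by rewrite in_itv/=; apply/andP; split; lra.
have sI' : s0 \in `[s0 - d, s0 + d] by exact: subset_itv_oo_cc.
have cf s : s \in `[s0 - d, s0 + d] -> cont01 (f s).
  move=> hs; rewrite /f => x x01; have [_ cF _] := hF _ (hd _ _ hs x01).
  apply: (proj2 (ccontM _ (ccont_cst (s%:C * (q - p)) x))).
  by apply: (cF _ _ _ erefl); apply: ccontM; [exact: ccont_cst|exact: ccont_seg].
have : is_derive s0 1 (fun s => I01 (f s)) (I01 (df s0)).
  apply: (@I01_derive R f df s0 (s0 - d) (s0 + d) M sI).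
    by move=> s /subset_itv_oo_cc; exact: cf.
  by move=> s x /subset_itv_oo_cc hs hx; split; [exact: dseg|exact: hM].
have -> : (fun s : R => imint F (s%:C * p) (s%:C * q)) = (fun s => I01 (f s)).
  apply/funext => s; apply: I01_eq => x _.
  by rewrite segZ /f (mulrBr s%:C).
congr is_derive.
have cdf : cont01 (df s0).
  move=> x x01; have [_ cF cdF] := hF _ (hd _ _ sI' x01).
  have cs := ccont_seg p q x; have ck (c : C) := ccont_cst c x.
  have csx := ccontM (ck s0%:C) cs.
  apply: (proj2 (ccontD (ccontM (ccontM _ cs) (ck _)) (ccontM _ (ck _)))).
    exact: (cdF _ _ _ _ csx).
  exact: (cF _ _ _ _ csx).
pose G (x : R) := Im (F (s0%:C * seg p q x) * seg p q x).
have dG (x : R) : x \in `[0, 1] -> is_derive x 1 G (df s0 x).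
  move=> x01; have [dFx _ _] := hF _ (hd _ _ sI' x01).
  have dz := cderivM (cderiv_cst s0%:C x) (cderiv_seg p q x).
  have [_] := cderivM (dFx _ _ _ erefl dz) (cderiv_seg p q x).
  by congr is_derive; congr Im; rewrite /df; ring.
by have -> := I01_FTC cdf dG; rewrite /G seg0 seg1.
Qed.

End Segments.

Section Paths.
Context {R : realType}.
Local Notation C := R[i].
Implicit Types (F dF : C -> C) (p q z : C) (ps : seq C) (D : C -> Prop).

(** Polygonal path from p through the vertices [ps]. *)
Fixpoint impath F p ps : R :=
  if ps is q :: ps' then imint F p q + impath F q ps' else 0.

Fixpoint allseg (P : C -> C -> Prop) p ps : Prop :=
  if ps is q :: ps' then P p q /\ allseg P q ps' else True.

Lemma allsegW (P Q : C -> C -> Prop) p ps : (forall p q, P p q -> Q p q) ->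
  allseg P p ps -> allseg Q p ps.
Proof.
by move=> PQ; elim: ps p => //= q ps IH p [/PQ h1 /IH h2].
Qed.

Lemma allseg_cat (P : C -> C -> Prop) p ps qs :
  allseg P p (ps ++ qs) <-> allseg P p ps /\ allseg P (last p ps) qs.
Proof.
elim: ps p => [|q ps IH] p /=; first by split=> [|[]].
by rewrite IH; split=> [[? []]|[[]]].
Qed.

Lemma impath_cat F p ps qs :
  impath F p (ps ++ qs) = impath F p ps + impath F (last p ps) qs.
Proof. by elim: ps p => [|q ps IH] p /=; rewrite ?add0r// IH addrA. Qed.

Lemma imint_eq F G p q : onseg (fun z => F z = G z) p q ->
  imint F p q = imint G p q.
Proof. by move=> FG; apply: I01_eq => x x01; rewrite FG. Qed.

Lemma impath_eq F G p ps : allseg (onseg (fun z => F z = G z)) p ps ->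
  impath F p ps = impath G p ps.
Proof.
by elim: ps p => //= q ps IH p [h1 h2]; rewrite (imint_eq h1) IH.
Qed.

Lemma imintD F G p q : onseg (cont_at F) p q -> onseg (cont_at G) p q ->
  imint (fun z => F z + G z) p q = imint F p q + imint G p q.
Proof.
move=> cF cG; rewrite -I01D; [|exact: cont_at_seg..].
by apply: I01_eq => x _; rewrite mulrDl cImD.
Qed.

Lemma imintZ (c : R) F p q : onseg (cont_at F) p q ->
  imint (fun z => c%:C * F z) p q = c * imint F p q.
Proof.
move=> cF; rewrite -I01Z; last exact: cont_at_seg.
by apply: I01_eq => x _; rewrite -mulrA cImM mul0r addr0.
Qed.

Lemma impathD F G p ps : allseg (onseg (cont_at F)) p ps ->
  allseg (onseg (cont_at G)) p ps ->
  impath (fun z => F z + G z) p ps = impath F p ps + impath G p ps.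
Proof.
elim: ps p => [|q ps IH] p /=; first by rewrite addr0.
by move=> [f1 f2] [g1 g2]; rewrite imintD// IH// addrACA.
Qed.

Lemma impathZ (c : R) F p ps : allseg (onseg (cont_at F)) p ps ->
  impath (fun z => c%:C * F z) p ps = c * impath F p ps.
Proof.
elim: ps p => [|q ps IH] p /=; first by rewrite mulr0.
by move=> [f1 f2]; rewrite imintZ// IH// mulrDr.
Qed.

Lemma cont_at_sum n (c : nat -> R) (F : nat -> C -> C) z :
  (forall i, cont_at (F i) z) ->
  cont_at (fun z => \sum_(i < n) (c i)%:C * F i z) z.
Proof.
move=> cF T f u fu cf; elim: n => [|n IH].
  by under eq_fun do rewrite big_ord0; exact: ccont_cst.
under eq_fun do rewrite big_ord_recr/=.
by apply: ccontD => //; apply: ccontM; [exact: ccont_cst|exact: cF].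
Qed.

Lemma impath_sum n (c : nat -> R) (F : nat -> C -> C) p ps :
  (forall i, allseg (onseg (cont_at (F i))) p ps) ->
  impath (fun z => \sum_(i < n) (c i)%:C * F i z) p ps =
  \sum_(i < n) c i * impath (F i) p ps.
Proof.
move=> cF; elim: n => [|n IH].
  rewrite big_ord0 (_ : (fun _ => _) = (fun z => (0 : R)%:C * F 0%N z)).
    by rewrite impathZ ?mul0r//; exact: cF.
  by apply/funext => z; rewrite big_ord0 mul0r.
rewrite big_ord_recr/= -IH -impathZ; last exact: cF.
rewrite -impathD.
- by congr impath; apply/funext => z; rewrite big_ord_recr.
- elim: ps p cF {IH} => //= q ps IH p cF; split; last first.
    by apply: IH => i; have [] := cF i.
  by move=> x x01; apply: cont_at_sum => i; have [+ _] := cF i; apply.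
- elim: ps p cF {IH} => //= q ps IH p cF; split; last first.
    by apply: IH => i; have [] := cF i.
  move=> x x01; have [/(_ x x01) cFn _] := cF n.
  by move=> T f u fu cf; apply: ccontM; [exact: ccont_cst|exact: cFn].
Qed.

Lemma imint_norm_le F p q K : onseg (cont_at F) p q ->
  onseg (fun z => normc (F z) <= K) p q -> `|imint F p q| <= K * normc (q - p).
Proof.
move=> cF FK; rewrite -[leRHS]I01_cst; apply: I01_norm_le.
- exact: cont_at_seg.
- exact: cont01_cst.
- move=> x x01; apply: le_trans (ler_Im_normc _) _; rewrite normcM.
  by rewrite ler_wpM2r ?normc_ge0 ?FK.
Qed.

Lemma holo_cont D F dF : holo D F dF ->
  forall p ps, allseg (onseg D) p ps -> allseg (onseg (cont_at F)) p ps.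
Proof.
move=> hF p ps; apply: allsegW => {}p q pq x x01.
by have [] := hF _ (pq x x01).
Qed.

Lemma impath_FTC D F dF p ps : holo D F dF -> allseg (onseg D) p ps ->
  impath dF p ps = Im (F (last p ps)) - Im (F p).
Proof.
move=> hF; elim: ps p => [|q ps IH] p /=; first by rewrite subrr.
by move=> [h1 h2]; rewrite (imint_FTC hF h1) IH//; ring.
Qed.

(** The contributions of inner vertices cancel. *)
Lemma impath_scale_derive D F dF p ps (s0 : R) : copen D -> holo D F dF ->
  allseg (onseg (fun z => D (s0%:C * z))) p ps ->
  is_derive s0 1 (fun s : R => impath F (s%:C * p) [seq s%:C * q | q <- ps])
    (Im (F (s0%:C * last p ps) * last p ps) - Im (F (s0%:C * p) * p)).
Proof.
move=> oD hF; elim: ps p => [|q ps IH] p /=.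
  by move=> _; rewrite subrr; exact: is_derive_cst.
move=> [h1 h2].
have := is_deriveD (imint_scale_derive oD hF h1) (IH _ h2).
by congr is_derive; rewrite /=; ring.
Qed.

(** Cauchy theorem in the form needed here: for a function real on the real axis,
    the imaginary part of the integral along the path dilated by s does not depend
    on s, as both end points are real; boundedness near 0 makes it tend to 0
    with s. *)
Lemma impath_vanish D F dF p ps (d K : R) : copen D -> holo D F dF ->
  allseg (sweep D) p ps -> Im p = 0 -> Im (last p ps) = 0 ->
  (forall z, Im z = 0 -> Im (F z) = 0) -> 0 < d ->
  (forall z, D z -> normc z < d -> normc (F z) <= K) ->
  impath F p ps = 0.
Proof.
move=> oD hF sw p0 l0 Freal d0 FK.
pose J (s : R) := impath F (s%:C * p) [seq s%:C * q | q <- ps].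
have sws (s : R) : 0 < s <= 1 -> allseg (onseg (fun z => D (s%:C * z))) p ps.
  by move=> s01; apply: allsegW sw => a b ab x x01; exact: ab.
have dJ (s : R) : 0 < s <= 1 -> is_derive s 1 J 0.
  move=> s01; have := impath_scale_derive oD hF (sws s s01).
  congr is_derive; rewrite !cImM p0 l0 !Freal ?cImM ?p0 ?l0 ?mul0r ?mulr0 ?addr0 ?subrr//.
have J1 : J 1 = impath F p ps.
  by rewrite /J mul1r; congr impath; rewrite -[RHS]map_id; apply: eq_map => q; rewrite mul1r.
have Jc (e : R) : 0 < e <= 1 -> J e = J 1.
  move=> /andP[e0 e1]; apply: derive0_const => // x; rewrite in_itv/= => /andP[h1 h2].
  by apply: dJ; rewrite h2 andbT (lt_le_trans e0).
have [L [L0 hL]] : exists L : R, 0 <= L /\ forall s : R, 0 < s <= 1 -> s * L < d ->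
    `|J s| <= K * (s * L).
  rewrite /J; elim: ps p sws {sw p0 l0 J dJ J1 Jc} => [|q ps IH] p sws /=.
    by exists 0; split=> // s _ _; rewrite normr0 !mulr0.
  have [|L [L0 hL]] := IH q; first by move=> s /sws[].
  exists (normc p + normc (q - p) + L); split.
    by rewrite !addr_ge0 ?normc_ge0.
  move=> s s01 sd; have s0 : 0 <= s by case/andP: s01 => /ltW.
  have [h1 h2] := sws s s01.
  have K0 x : x \in `[0, 1] ->  normc (F (s%:C * seg p q x)) <= K.
    move=> x01; apply: FK; first exact: h1.
    rewrite normcM normc_real ger0_norm//; apply: le_lt_trans sd.
    rewrite ler_wpM2l// (le_trans (le_normcD _ _))// normcM normc_real.
    move: x01; rewrite in_itv/= => /andP[x0 x1]; rewrite ger0_norm//.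
    have := normc_ge0 (q - p); have := normc_ge0 p; nra.
  have K00 : 0 <= K.
    by apply: le_trans (normc_ge0 _) (K0 0 _); rewrite in_itv/= lexx ler01.
  apply: le_trans (ler_normD _ _) _.
  have e1 : `|imint F (s%:C * p) (s%:C * q)| <= K * (s * normc (q - p)).
    have -> : s * normc (q - p) = normc (s%:C * q - s%:C * p).
      by rewrite -mulrBr normcM normc_real ger0_norm.
    apply: imint_norm_le => x x01; rewrite segZ.
      by have [] := hF _ (h1 x x01).
    exact: K0.
  have e2 : `|impath F (s%:C * q) [seq s%:C * q0 | q0 <- ps]| <= K * (s * L).
    apply: hL => //; apply: le_lt_trans sd; rewrite ler_wpM2l//.
    by rewrite lerDr addr_ge0 ?normc_ge0.
  have e3 : 0 <= K * (s * normc p) by rewrite !mulr_ge0 ?normc_ge0.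
  by apply: le_trans (lerD e1 e2) _; rewrite !mulrDr; lra.
apply/eqP; rewrite -J1 -normr_eq0 eq_le normr_ge0 andbT.
apply/ler_addgt0Pl => e e0; rewrite addr0.
(* Small enough for the dilated path to stay in the disc of radius d, and for
   the bound K s L to be at most e. *)
pose s := Num.min 1 (Num.min (d / (2 * (L + 1))) (e / (`|K| + 1) / (L + 1))).
have L1 : 0 < L + 1 by lra.
have K1 : 0 < `|K| + 1 by rewrite ltr_wpDl.
have s01 : 0 < s <= 1.
  by rewrite /s !lt_min ltr01 ge_min lexx !divr_gt0// mulr_gt0.
have sL1 : s <= d / (2 * (L + 1)) by rewrite /s !ge_min lexx !orbT.
have sL2 : s <= e / (`|K| + 1) / (L + 1) by rewrite /s !ge_min lexx !orbT.
case/andP: (s01) => s0 _; rewrite -(Jc s s01).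
apply: le_trans (hL s s01 _) _.
  move: sL1; rewrite ler_pdivlMr ?mulr_gt0// => h; apply: lt_le_trans (_ : d <= d) => //.
  have : 0 < s * (L + 1) by rewrite mulr_gt0.
  move=> h'; nra.
apply: le_trans (ler_norm _) _; rewrite normrM (ger0_norm (mulr_ge0 (ltW s0) L0)).
move: sL2; rewrite !ler_pdivlMr// => h.
have : 0 <= `|K| by [].
have : 0 <= s * L by rewrite mulr_ge0// ltW.
nra.
Qed.

(** The argument, continuous outside the negative imaginary half-line: the half-angle
    formula applied to z / i. *)
Definition upper_arg z : R := pi / 2 - 2 * atan (Re z / (normc z + Im z)).

Lemma imint_inv p q : onseg (fun z => 0 < normc z + Im z) p q ->
  imint (fun z => z^-1) p q = upper_arg q - upper_arg p.
Proof.
move=> h.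
have nz x : x \in `[0, 1] -> seg p q x != 0.
  move=> /h; apply: contraTneq => ->; by rewrite normc0 addr0 ltxx.
have cf : cont01 (fun x => Im ((seg p q x)^-1 * (q - p))).
  move=> x x01; apply: (proj2 (ccontM (ccontV _ _) (ccont_cst _ x))).
    exact: nz.
  exact: ccont_seg.
rewrite -[in RHS](seg1 p q) -[in X in _ - X](seg0 p q).
apply: (I01_FTC (F := fun x => upper_arg (seg p q x)) cf).
move=> x x01; have [da db] := cderiv_seg p q x.
have rb := h x x01; have rn := nz x x01.
set z := seg p q x in rb rn *.
set a' := Re (q - p) in da *; set b' := Im (q - p) in db *.
have rE := normc_sqr z.
have r0 : 0 < normc z by rewrite normc_gt0.
have dr : is_derive x 1 (fun u => normc (seg p q u))
    ((2 * normc z)^-1 * (2 * Re z * a' + 2 * Im z * b')).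
  have -> : (fun u => normc (seg p q u)) = (fun u => Num.sqrt
      (Re (seg p q u) ^+ 2 + Im (seg p q u) ^+ 2)).
    by apply/funext => u; case: (seg p q u).
  have d2 : is_derive x 1 (fun u => Re (seg p q u) ^+ 2 + Im (seg p q u) ^+ 2)
      (2 * Re z * a' + 2 * Im z * b').
    by apply: is_derive_eq; rewrite /GRing.scale/=; ring.
  have zn : normc z = Num.sqrt (Re z ^+ 2 + Im z ^+ 2) by case: (z).
  rewrite zn; apply: (@is_derive1_comp _ (@Num.sqrt R)).
  by apply: is_derive1_sqrt; rewrite -normc_sqr exprn_gt0.
have rb0 : normc z + Im z != 0 by rewrite gt_eqF.
have dv : is_derive x 1 (fun u => (normc (seg p q u) + Im (seg p q u))^-1)
    (- (normc z + Im z) ^- 2 * ((2 * normc z)^-1 * (2 * Re z * a' + 2 * Im z * b') + b')).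
  apply: (@is_deriveV _ (fun u => normc (seg p q u) + Im (seg p q u)) x _ 1 rb0).
have dq : is_derive x 1 (fun u => Re (seg p q u) / (normc (seg p q u) + Im (seg p q u)))
   (Re z * (- (normc z + Im z) ^- 2 * ((2 * normc z)^-1 * (2 * Re z * a' + 2 * Im z * b') + b'))
    + a' / (normc z + Im z)).
  by apply: is_derive_eq; rewrite /GRing.scale/= -/z; ring.
have dat : is_derive x 1
    (fun u => atan (Re (seg p q u) / (normc (seg p q u) + Im (seg p q u)))) _ :=
  @is_derive1_comp _ (@atan R) _ x _ _ (is_derive1_atan _) dq.
rewrite /upper_arg; apply: is_derive_eq.
rewrite cImM cReV cImV -normc_sqr -/a' -/b' /GRing.scale/=.
rewrite -/z; move: (Re z) (Im z) (normc z) rE r0 rb0 => a b r rE r0 rb0.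
have r00 : r != 0 by rewrite gt_eqF.
have -> : 1 + (a / (r + b)) ^+ 2 = 2 * r / (r + b).
  apply/eqP; rewrite -subr_eq0.
  have -> : 1 + (a / (r + b)) ^+ 2 - 2 * r / (r + b) =
    (a ^+ 2 + b ^+ 2 - r ^+ 2) / (r + b) ^+ 2 by field.
  by rewrite rE subrr mul0r.
(* Up to the factor below, both sides differ by a^2 + b^2 - r^2 = 0. *)
apply/eqP; rewrite -subr_eq0; apply/eqP.
transitivity (a' * (a ^+ 2 + b ^+ 2 - r ^+ 2) / (r ^+ 2 * (r + b))).
  by field; rewrite r00 rb0.
by rewrite rE subrr mulr0 mul0r.
Qed.

Lemma impath_inv p ps :
  allseg (onseg (fun z => 0 <= Im z /\ z != 0)) p ps ->
  Im p = 0 -> 0 < Re p -> Im (last p ps) = 0 -> Re (last p ps) < 0 ->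
  impath (fun z => z^-1) p ps = pi.
Proof.
move=> h p0 rp l0 rl.
have arg_real (x : R) : x != 0 -> upper_arg x%:C = pi / 2 - 2 * atan (Num.sg x).
  move=> x0; rewrite /upper_arg normc_real addr0/=; congr (_ - 2 * atan _).
  by rewrite {1}(numEsg x) mulfK// normr_eq0.
have -> : impath (fun z => z^-1) p ps = upper_arg (last p ps) - upper_arg p.
  elim: ps p h {p0 rp l0 rl} => [|q ps IH] p /=; first by rewrite subrr.
  move=> [h1 h2]; rewrite imint_inv ?IH//; first by ring.
  by move=> x /h1[i0 z0]; rewrite ltr_pwDl// normc_gt0.
have eL : last p ps = (Re (last p ps))%:C by exact: complexP.
have ep : p = (Re p)%:C by exact: complexP.
have -> : upper_arg (last p ps) = pi.
  by rewrite eL arg_real ?lt_eqF// (ltr0_sg rl) atanN atan1; field.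
have -> : upper_arg p = 0.
  by rewrite ep arg_real ?gt_eqF// (gtr0_sg rp) atan1; field.
by rewrite subr0.
Qed.

End Paths.

(** * Taylor remainders of the exponential and the negative binomial series *)

Section ExpRemainders.
Context {R : realType}.
Local Notation C := R[i].
Implicit Types z : C.

(** The function whose p-th power divided by p! is, up to signs, the exponential
    generating function of the numbers of partitions into p blocks of size at
    least 2. *)
Definition exp_tail z : C := cexp (- z) - 1 + z.

Lemma exp_tail0 : exp_tail 0 = 0.
Proof. by rewrite /exp_tail oppr0 cexp0 subrr addr0. Qed.

Lemma holo_exp_tail (D : C -> Prop) :
  exists dg, holo D exp_tail dg /\ forall z, dg z = z - exp_tail z.
Proof.
have hN : holo D (fun z => - z) (fun _ => - 1) by exact/holoN/holo_id.
exists (fun z => - 1 * cexp (- z) + - 0 + 1); split; last first.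
  by move=> z; rewrite /exp_tail; ring.
apply: (holoD _ (@holo_id _ D)).
exact: (holoD (holo_exp hN) (holoN (@holo_cst _ D 1))).
Qed.

(** Mean value inequality; the factor 2 comes from treating the real and the
    imaginary part separately. *)
Lemma cderiv_bound (f df : R -> C) K : (forall x : R, x \in `[0, 1] ->
    cderiv f x (df x) /\ normc (df x) <= K) -> f 0 = 0 -> normc (f 1) <= 2 * K.
Proof.
move=> h f0; apply: le_trans (normc_le_ReIm _) _.
rewrite mulr_natl mulr2n; apply: lerD.
  have df' (x : R) : x \in `]0, 1[ -> is_derive x 1 (fun u => Re (f u)) (Re (df x)).
    by move=> /subset_itv_oo_cc/h[[]].
  have cf : {within `[0, 1], continuous (fun u : R => Re (f u))}.
    apply: continuous_in_subspaceT => x /set_mem/h[/cderiv_ccont[+ _] _].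
    exact.
  have [c /subset_itv_oo_cc/h[_ c1]] := MVT ltr01 df' cf.
  rewrite f0 !subr0 mulr1 => ->.
  exact: le_trans (ler_Re_normc _) c1.
have df' (x : R) : x \in `]0, 1[ -> is_derive x 1 (fun u => Im (f u)) (Im (df x)).
  by move=> /subset_itv_oo_cc/h[[]].
have cf : {within `[0, 1], continuous (fun u : R => Im (f u))}.
  apply: continuous_in_subspaceT => x /set_mem/h[/cderiv_ccont[_ +] _].
  exact.
have [c /subset_itv_oo_cc/h[_ c1]] := MVT ltr01 df' cf.
rewrite f0 !subr0 mulr1 => ->.
exact: le_trans (ler_Im_normc _) c1.
Qed.

Let cderiv_ray z (x : R) : cderiv (fun u : R => u%:C * z) x z.
Proof.
apply: cderiv_eq (cderivM (cderiv_real (@is_derive_id _ _ x (1 : R)))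
  (cderiv_cst z x)) _.
by rewrite mulr0 addr0 mul1r.
Qed.

Let normc_ray z (x : R) : x \in `[0, 1] -> normc (x%:C * z) <= normc z.
Proof.
rewrite in_itv/= => /andP[x0 x1]; rewrite normcM normc_real ger0_norm//.
by rewrite ler_piMl ?normc_ge0.
Qed.

Let e1 : R := expR 1.
Let e1_gt0 : 0 < e1. Proof. exact: expR_gt0. Qed.

Lemma normc_cexpB1 z : normc z <= 1 -> normc (cexp (- z) - 1) <= 2 * (e1 * normc z).
Proof.
move=> z1.
have := @cderiv_bound (fun x => cexp (- (x%:C * z)) - 1)
  (fun x => - z * cexp (- (x%:C * z))) (e1 * normc z).
rewrite mul1r mul0r oppr0 cexp0 subrr; apply => // x x01; split.
  apply: cderiv_eq (cderivD (cderiv_exp (cderivN (cderiv_ray z x))) (cderiv_cst _ x)) _.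
  by rewrite addr0.
rewrite normcM normcN normc_cexp mulrC ler_wpM2r ?normc_ge0// ler_expR cReN.
have := le_trans (normc_ray z x01) z1; have := ler_Re_normc (x%:C * z).
by rewrite ler_norml => /andP[]; lra.
Qed.

(** Integrating the bound for exp(-z) - 1 along the ray from 0 to z; the same
    step leads from here to the third-order bound below. *)
Lemma normc_exp_tail2 z : normc z <= 1 -> normc (exp_tail z) <= 4 * (e1 * normc z ^+ 2).
Proof.
move=> z1.
have := @cderiv_bound (fun x => exp_tail (x%:C * z))
  (fun x => - z * (cexp (- (x%:C * z)) - 1)) (2 * (e1 * normc z ^+ 2)).
rewrite (_ : 4 * _ = 2 * (2 * (e1 * normc z ^+ 2))); last by ring.
rewrite mul1r mul0r exp_tail0; apply=> // x x01; split.
  apply: cderiv_eq (cderivD (cderivD (cderiv_exp (cderivN (cderiv_ray z x)))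
    (cderiv_cst _ x)) (cderiv_ray z x)) _.
  by ring.
rewrite normcM normcN.
have bz := normc_ray z x01; have := le_trans bz z1.
move=> /normc_cexpB1 h; have z0 := normc_ge0 z.
apply: le_trans (ler_wpM2l z0 h) _.
have := ler_wpM2l (mulr_ge0 z0 (ltW e1_gt0)) bz; lra.
Qed.

Lemma normc_exp_tail3 z : normc z <= 1 ->
  normc (exp_tail z - z ^+ 2 / 2%:R) <= 8 * (e1 * normc z ^+ 3).
Proof.
move=> z1.
have := @cderiv_bound (fun x => exp_tail (x%:C * z) - (x%:C * z) ^+ 2 / 2%:R)
  (fun x => - z * exp_tail (x%:C * z)) (4 * (e1 * normc z ^+ 3)).
rewrite (_ : 8 * _ = 2 * (4 * (e1 * normc z ^+ 3))); last by ring.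
rewrite mul1r mul0r exp_tail0 expr0n/= mul0r subrr.
apply=> // x x01; split.
  apply: cderiv_eq (cderivD (cderivD (cderivD (cderiv_exp (cderivN (cderiv_ray z x)))
    (cderiv_cst _ x)) (cderiv_ray z x)) (cderivN (cderivM (cderivM (cderiv_ray z x)
     (cderiv_ray z x)) (cderiv_cst _ x)))) _.
  by rewrite /exp_tail; field.
rewrite normcM normcN.
have h := normc_ray z x01; have := le_trans h z1.
move=> /normc_exp_tail2 hg; have z0 := normc_ge0 z.
have h2 : normc (x%:C * z) ^+ 2 <= normc z ^+ 2 by rewrite ler_pXn2r ?nnegrE ?normc_ge0.
have h3 : normc (exp_tail (x%:C * z)) <= 4 * (e1 * normc z ^+ 2).
  by apply: le_trans hg _; rewrite ler_wpM2l// ler_wpM2l// ltW.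
apply: le_trans (ler_wpM2l z0 h3) _.
by rewrite le_eqVlt; apply/orP; left; apply/eqP; ring.
Qed.

End ExpRemainders.

Section NegativeBinomial.
Context {R : realType}.
Local Notation C := R[i].

Lemma normc_nat n : normc (n%:R : C) = n%:R.
Proof. by rewrite -(rmorph_nat (real_complex R)) normc_real normr_nat. Qed.

(** By Pascal rule, multiplying the truncated series of (1 - v)^(-m-1) by 1 - v
    leaves the truncated series of (1 - v)^(-m) and one boundary term. *)
Lemma negbin_step (m M : nat) (v : C) :
  (1 - v) * \sum_(p < M.+1) 'C(m + p, p)%:R * v ^+ p =
  \sum_(p < M.+1) 'C((m + p).-1, p)%:R * v ^+ p - 'C(m + M, M)%:R * v ^+ M.+1.
Proof.
elim: M => [|M IH].
  by rewrite !big_ord_recr !big_ord0/= !bin0 !expr0 !expr1; ring.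
rewrite big_ord_recr/= mulrDr IH [in RHS]big_ord_recr/=.
have -> : 'C(m + M.+1, M.+1)%:R = 'C((m + M.+1).-1, M.+1)%:R + 'C(m + M, M)%:R :> C.
  by rewrite addnS/= binS natrD.
by rewrite [v ^+ M.+2]exprS; ring.
Qed.

Lemma negbin_remainder (m M : nat) : exists K : R, 0 <= K /\
  forall v : C, normc v <= 1 / 2 ->
  normc ((1 - v)^-1 ^+ m - \sum_(p < M.+1) 'C((m + p).-1, p)%:R * v ^+ p)
    <= K * normc v ^+ M.+1.
Proof.
elim: m => [|m [K [K0 hK]]].
  exists 0; split=> // v _; rewrite mul0r expr0 big_ord_recl/= bin0 expr0 mulr1.
  rewrite big1 ?addr0 ?subrr ?normc0// => i _.
  by rewrite /bump/= add0n add1n/= bin_small ?mul0r.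
exists (2 * (K + 'C(m + M, M)%:R)); split.
  by rewrite mulr_ge0// addr_ge0// ler0n.
move=> v v2; have v1 : 1 / 2 <= normc (1 - v).
  by have := normcB_le 1 v; rewrite normc1; lra.
have nv : 1 - v != 0 by rewrite -normc_gt0; lra.
set B := \sum_(p < M.+1) 'C((m.+1 + p).-1, p)%:R * v ^+ p.
have eB : (1 - v) * B = \sum_(p < M.+1) 'C((m + p).-1, p)%:R * v ^+ p
     - 'C(m + M, M)%:R * v ^+ M.+1 by rewrite -negbin_step.
have -> : (1 - v)^-1 ^+ m.+1 - B = (1 - v)^-1 *
  (((1 - v)^-1 ^+ m - \sum_(p < M.+1) 'C((m + p).-1, p)%:R * v ^+ p) +
   'C(m + M, M)%:R * v ^+ M.+1).
  have -> : 'C(m + M, M)%:R * v ^+ M.+1 =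
      \sum_(p < M.+1) 'C((m + p).-1, p)%:R * v ^+ p - (1 - v) * B by rewrite eB; ring.
  by rewrite exprS; field.
rewrite normcM -mulrA; apply: ler_pM; rewrite ?normc_ge0//.
  rewrite normcV -[2]invrK lef_pV2 ?posrE ?normc_gt0//; lra.
apply: le_trans (le_normcD _ _) _; rewrite mulrDl lerD ?hK//.
by rewrite normcM normcX normc_nat.
Qed.

End NegativeBinomial.

(** * The coefficients as path integrals *)

Section CoefficientIntegral.
Context {R : realType}.
Local Notation C := R[i].
Variables (sigma : R) (sigma_gt0 : 0 < sigma).
Implicit Types z : C.

(** The entire function whose inverse has the c_m as Taylor coefficients. *)
Definition tfun z : C := sigma%:C * z + 1 - cexp (- z).

Definition regular z := z != 0 /\ tfun z != 0.

Definition holomorphic (D : C -> Prop) F := exists dF, holo D F dF.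

Lemma holomorphicX (D : C -> Prop) F n : holomorphic D F ->
  holomorphic D (fun z => F z ^+ n).
Proof. by move=> [dF hF]; have [dG [hG _]] := holoX n hF; exists dG. Qed.

Lemma holomorphicM (D : C -> Prop) F G : holomorphic D F -> holomorphic D G ->
  holomorphic D (fun z => F z * G z).
Proof. by move=> [dF hF] [dG hG]; eexists; exact: holoM hF hG. Qed.

Lemma holomorphicD (D : C -> Prop) F G : holomorphic D F -> holomorphic D G ->
  holomorphic D (fun z => F z + G z).
Proof. by move=> [dF hF] [dG hG]; eexists; exact: holoD hF hG. Qed.

Lemma holomorphicV (D : C -> Prop) F : (forall z, D z -> F z != 0) ->
  holomorphic D F -> holomorphic D (fun z => (F z)^-1).
Proof. by move=> F0 [dF hF]; eexists; exact: holoV F0 hF. Qed.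

Lemma holomorphic_cst (D : C -> Prop) c : holomorphic D (fun _ => c).
Proof. by eexists; exact: holo_cst. Qed.

Lemma holomorphic_sum (D : C -> Prop) n (c : nat -> C) (F : nat -> C -> C) :
  (forall i, holomorphic D (F i)) ->
  holomorphic D (fun z => \sum_(i < n) c i * F i z).
Proof.
move=> hF; elim: n => [|n IH].
  by under eq_fun do rewrite big_ord0; exact: holomorphic_cst.
under eq_fun do rewrite big_ord_recr/=; apply: holomorphicD => //.
by apply: holomorphicM => //; exact: holomorphic_cst.
Qed.

Lemma holomorphic_tfun (D : C -> Prop) : holomorphic D tfun.
Proof.
have hN : holo D (fun z => - z) (fun _ => - 1) by exact/holoN/holo_id.
apply: holomorphicD; last by eexists; apply: holoN; exact: holo_exp hN.
apply: holomorphicD; last exact: holomorphic_cst.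
apply: holomorphicM; first exact: holomorphic_cst.
by eexists; exact: holo_id.
Qed.

Lemma holomorphic_exp_tail (D : C -> Prop) : holomorphic D exp_tail.
Proof. by have [dg [h _]] := holo_exp_tail D; exists dg. Qed.

Lemma holo_inv_id : holo regular (fun z => z^-1) (fun z => - (1 * (z^-1 * z^-1))).
Proof. by apply: (holoV _ (@holo_id _ regular)) => z []. Qed.

Lemma holomorphic_inv : holomorphic regular (fun z => z^-1).
Proof. by eexists; exact: holo_inv_id. Qed.

Lemma ccont_neq0 (T : topologicalType) (f : T -> C) u : ccont f u ->
  f u != 0 -> \forall v \near u, f v != 0.
Proof.
move=> /continuous_normc_sqr cf fu0.
have : 0 < normc (f u) ^+ 2 by rewrite exprn_gt0// normc_gt0.
move=> /(cvgr_gt _ cf); apply: filterS => v.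
by apply: contraTneq => ->; rewrite normc0 expr0n/= ltxx.
Qed.

Lemma copen_regular : copen regular.
Proof.
move=> T f u cf [f0 tf0].
have [dt ht] := holomorphic_tfun (fun _ => True).
have [_ ct _] := ht (f u) I.
have h1 := ccont_neq0 cf f0.
have h2 := ccont_neq0 (ct _ _ _ erefl cf) tf0.
by near=> v; split; near: v.
Unshelve. all: by end_near. Qed.

Lemma Im_real_mul z w : Im z = 0 -> Im w = 0 -> Im (z * w) = 0.
Proof. by move=> z0 w0; rewrite cImM z0 w0 mulr0 mul0r addr0. Qed.

Lemma Im_real_exp z n : Im z = 0 -> Im (z ^+ n) = 0.
Proof. by move=> z0; elim: n => // n IH; rewrite exprS Im_real_mul. Qed.

Lemma Im_real_inv z : Im z = 0 -> Im z^-1 = 0.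
Proof. by move=> z0; rewrite cImV z0 mul0r oppr0. Qed.

Lemma Im_real_cexp z : Im z = 0 -> Im (cexp (- z)) = 0.
Proof. by move=> z0; rewrite /= cImN z0 oppr0 sin0 mulr0. Qed.

Lemma Im_real_exp_tail z : Im z = 0 -> Im (exp_tail z) = 0.
Proof.
by move=> z0; rewrite /exp_tail !cImD z0 Im_real_cexp// cImN/= !(addr0, add0r) oppr0.
Qed.

Lemma Im_real_tfun z : Im z = 0 -> Im (tfun z) = 0.
Proof.
move=> z0; rewrite /tfun !cImD cImN Im_real_cexp// Im_real_mul//=.
by rewrite !(addr0, add0r) oppr0.
Qed.

Variables (p0 : C) (ps : seq C).
Hypothesis path_sweep : allseg (sweep regular) p0 ps.
Hypothesis path_upper : allseg (onseg (fun z => 0 <= Im z)) p0 ps.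
Hypotheses (p0_real : Im p0 = 0) (p0_gt0 : 0 < Re p0).
Hypotheses (pl_real : Im (last p0 ps) = 0) (pl_lt0 : Re (last p0 ps) < 0).

Let path_regular : allseg (onseg regular) p0 ps.
Proof. by apply: allsegW path_sweep; exact: sweep_onseg. Qed.

(** pi times the residue at 0 of exp_tail(z)^p z^(-n), as an integral over the path. *)
Definition moment n p := impath (fun z => exp_tail z ^+ p * z^-1 ^+ n) p0 ps.

Let holomorphic_moment n p : holomorphic regular (fun z => exp_tail z ^+ p * z^-1 ^+ n).
Proof.
apply: holomorphicM; apply: holomorphicX; first exact: holomorphic_exp_tail.
exact: holomorphic_inv.
Qed.

Let cont_moment n p :
  allseg (onseg (cont_at (fun z => exp_tail z ^+ p * z^-1 ^+ n))) p0 ps.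
Proof. by have [dF hF] := holomorphic_moment n p; exact: holo_cont hF _ _ _. Qed.

Let Im_real_moment n p z : Im z = 0 -> Im (exp_tail z ^+ p * z^-1 ^+ n) = 0.
Proof.
by move=> z0; apply: Im_real_mul; apply: Im_real_exp; rewrite ?Im_real_exp_tail ?Im_real_inv.
Qed.

Let e1 : R := expR 1.

Let exp_tail_le (z : C) : normc z < 1 -> normc (exp_tail z) <= 4 * e1.
Proof.
move=> z1; have := normc_exp_tail2 (ltW z1); have := normc_ge0 z.
have : 0 < e1 by exact: expR_gt0.
rewrite -/e1 => e0 z0 h; apply: le_trans h _; rewrite ler_wpM2l// ler_piMr ?(ltW e0)//.
by rewrite expr_le1// ltW.
Qed.

Lemma moment0 p : moment 0 p = 0.
Proof.
have [dF hF] := holomorphic_moment 0 p.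
apply: (impath_vanish copen_regular hF path_sweep p0_real pl_real _ ltr01
  (K := (4 * e1) ^+ p)) => [z z0|z _ z1]; first exact: Im_real_moment.
by rewrite expr0 mulr1 normcX lerXn2r ?nnegrE ?normc_ge0 ?exp_tail_le// mulr_ge0// expR_ge0.
Qed.

Lemma moment1S p : moment 1 p.+1 = 0.
Proof.
have [dF hF] := holomorphic_moment 1 p.+1.
apply: (impath_vanish copen_regular hF path_sweep p0_real pl_real _ ltr01
  (K := (4 * e1) ^+ p * (4 * e1))) => [z z0|z [z0 _] z1]; first exact: Im_real_moment.
have e0 : 0 < e1 by exact: expR_gt0.
rewrite exprSr expr1 -mulrA normcM; apply: ler_pM; rewrite ?normc_ge0//.
  by rewrite normcX lerXn2r ?nnegrE ?normc_ge0 ?exp_tail_le// mulr_ge0// expR_ge0.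
rewrite normcM normcV ler_pdivrMr ?normc_gt0//.
apply: le_trans (normc_exp_tail2 (ltW z1)) _; rewrite -/e1.
have := ler_wpM2l (mulr_ge0 (ltW e0) (normc_ge0 z)) (ltW z1); lra.
Qed.

Lemma moment10 : moment 1 0 = pi.
Proof.
rewrite -(@impath_inv _ p0 ps)//; last first.
  elim: ps p0 path_upper path_regular => //= q qs IH p [u1 u2] [d1 d2]; split.
    by move=> x x01; split; [exact: u1|have [] := d1 x x01].
  exact: IH.
by rewrite /moment; congr impath; apply/funext => z; rewrite mul1r.
Qed.

Lemma momentSS0 n : moment n.+2 0 = 0.
Proof.
have [dG [hG eG]] := holoX n.+1 holo_inv_id.
have := impath_FTC hG path_regular.
rewrite !Im_real_exp ?Im_real_inv// subrr.
have eq1 z : regular z -> dG z = (- n.+1%:R : R)%:C * (exp_tail z ^+ 0 * z^-1 ^+ n.+2).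
  move=> Dz; rewrite eG//= !exprS mul1r -!exprS rmorphN rmorph_nat.
  by rewrite !exprS; ring.
rewrite (@impath_eq _ _ (fun z => (- n.+1%:R : R)%:C * (exp_tail z ^+ 0 * z^-1 ^+ n.+2))).
  rewrite impathZ; last exact: cont_moment.
  by move=> /eqP; rewrite mulf_eq0 oppr_eq0 pnatr_eq0/= => /eqP.
by apply: allsegW path_regular => p q pq x x01; apply/eq1/pq.
Qed.

(** Integration by parts, using that the derivative of exp_tail is z - exp_tail z;
    this is the recurrence of the associated Stirling numbers. *)
Lemma moment_rec n p : n.+1%:R * moment n.+2 p.+1 =
  p.+1%:R * (moment n p - moment n.+1 p.+1).
Proof.
have [dg [hg eg]] := holo_exp_tail regular.
have [dG [hG eG]] := holoX p.+1 hg.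
have [dH [hH eH]] := holoX n.+1 holo_inv_id.
have hF := holoM hG hH.
have := impath_FTC hF path_regular.
rewrite !Im_real_mul ?Im_real_exp ?Im_real_inv ?Im_real_exp_tail// subrr.
pose G z := (p.+1%:R : R)%:C * (exp_tail z ^+ p * z^-1 ^+ n) +
  ((- p.+1%:R : R)%:C * (exp_tail z ^+ p.+1 * z^-1 ^+ n.+1) +
   (- n.+1%:R : R)%:C * (exp_tail z ^+ p.+1 * z^-1 ^+ n.+2)).
have cZ (c : R) m q :
    allseg (onseg (cont_at (fun z => c%:C * (exp_tail z ^+ q * z^-1 ^+ m)))) p0 ps.
  have [dF hF'] := holomorphicM (holomorphic_cst regular c%:C) (holomorphic_moment m q).
  exact: holo_cont hF' _ _ _.
have cD (c c' : R) m q m' q' : allseg (onseg (cont_at (fun z =>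
    c%:C * (exp_tail z ^+ q * z^-1 ^+ m) + c'%:C * (exp_tail z ^+ q' * z^-1 ^+ m')))) p0 ps.
  have [dF hF'] := holomorphicD
    (holomorphicM (holomorphic_cst regular c%:C) (holomorphic_moment m q))
    (holomorphicM (holomorphic_cst regular c'%:C) (holomorphic_moment m' q')).
  exact: holo_cont hF' _ _ _.
rewrite (@impath_eq _ _ G).
  rewrite /G impathD; [|exact: cZ|exact: cD].
  rewrite impathD; [|exact: cZ|exact: cZ].
  rewrite !impathZ; [|exact: cont_moment..].
  by rewrite -!/(moment _ _); lra.
apply: allsegW path_regular => a b ab x x01; set z := seg a b x.
have Dz := ab x x01; have [z0 _] := Dz.
rewrite /G eG// eH// eg/= !rmorphN !rmorph_nat !exprS.
by field.
Qed.

(** Both sides satisfy the same recurrence; the initial values are those of the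
    bounded integrands, which vanish, of 1 / z, which gives pi, and of the higher
    powers of 1 / z, which have primitives. *)
Lemma momentE n p : moment n.+1 p =
  pi * (-1) ^+ n * (p`!%:R / n`!%:R) * (stirling2_assoc n p)%:R.
Proof.
have fn0 k : (k`!%:R : R) != 0 by rewrite pnatr_eq0 -lt0n fact_gt0.
suff h N : forall n p, (n <= N)%N -> moment n.+1 p =
    pi * (-1) ^+ n * (p`!%:R / n`!%:R) * (stirling2_assoc n p)%:R by exact: (h n).
elim: N => [|N IH] {}n {}p.
  rewrite leqn0 => /eqP ->; rewrite stirling2_assocE/=.
  case: p => [|p]; last by rewrite moment1S mulr0.
  by rewrite moment10 divff// expr0 !mulr1.
case: n => [|n] nN; first by rewrite IH.
rewrite stirling2_assocE/=; case: p => [|p].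
  by rewrite momentSS0 mulr0.
have n1 : (n.+1%:R : R) != 0 by rewrite pnatr_eq0.
apply: (mulfI n1); rewrite moment_rec IH// -!stirling2_assocE.
rewrite factS natrM.
case: n nN n1 => [|n] nN n1.
  rewrite moment0 addn0 natrM expr0 expr1 (_ : 0`! = 1%N)// (_ : 1`! = 1%N)//.
  by field.
rewrite -stirling2_assocE IH; last by lia.
rewrite (factS n.+1) (factS n) !natrM natrD !natrM !exprS.
by field; rewrite fn0 -(natrD _ 1 n) -(natrD _ 2 n) !pnatr_eq0.
Qed.

Let zeta : R := (1 + sigma)^-1.

(** Write tfun z = (z / zeta) (1 - v) with v = zeta exp_tail(z) / z = O(z), expand
    (1 - v)^(-m) up to v^(m-1), and integrate term by term with [momentE].  The
    remainder is z^(-m) O(v^m), hence bounded near 0, and does not contribute. *)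
Lemma coef_cE m : (0 < m)%N ->
  coef_c sigma m = (pi * m%:R)^-1 * impath (fun z => (tfun z)^-1 ^+ m) p0 ps.
Proof.
case: m => // m _.
(* The coefficients of the truncated negative binomial expansion. *)
pose a (p : nat) : R := 'C((m.+1 + p).-1, p)%:R * zeta ^+ (m.+1 + p).
pose P z := \sum_(p < m.+1) (a p)%:C * (exp_tail z ^+ p * z^-1 ^+ (m.+1 + p)).
have hP : holomorphic regular P.
  exact: (@holomorphic_sum regular m.+1 (fun p => (a p)%:C)
    (fun p z => exp_tail z ^+ p * z^-1 ^+ (m.+1 + p))
    (fun p => holomorphic_moment (m.+1 + p) p)).
have ht : holomorphic regular (fun z => (tfun z)^-1 ^+ m.+1).
  apply/holomorphicX/holomorphicV; first by move=> z [].
  exact: holomorphic_tfun.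
have hNP : holomorphic regular (fun z => (-1 : R)%:C * P z).
  by apply: holomorphicM => //; exact: holomorphic_cst.
have e0 : 0 < e1 by exact: expR_gt0.
have e1_ge1 : 1 <= e1 by rewrite /e1 -[leLHS]expR0 ler_expR.
have vanish : impath (fun z => (tfun z)^-1 ^+ m.+1 + (-1 : R)%:C * P z) p0 ps = 0.
  have [dF hF] := holomorphicD ht hNP.
  have [K [K0 hK]] := @negbin_remainder R m.+1 m.
  have d0 : 0 < (8 * e1)^-1 by rewrite invr_gt0 mulr_gt0.
  apply: (impath_vanish copen_regular hF path_sweep p0_real pl_real _ d0
    (K := K * (4 * e1) ^+ m.+1)) => [z zr|z [z0 tz0] zd].
    rewrite cImD Im_real_exp ?Im_real_inv ?Im_real_tfun// add0r Im_real_mul//.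
    apply: (big_ind (fun w => Im w = 0)) => // [x y x0 y0|i _].
      by rewrite cImD x0 y0 addr0.
    by rewrite Im_real_mul// Im_real_moment.
  have nz : 0 < normc z by rewrite normc_gt0.
  have zd' : normc z * (8 * e1) < 1.
    by rewrite -ltr_pdivlMr ?mulr_gt0// div1r.
  have z1 : normc z <= 1.
    have : normc z * 1 <= normc z * e1 by rewrite ler_wpM2l ?(ltW nz).
    by have := mulr_gt0 nz e0; lra.
  pose v := zeta%:C * (exp_tail z * z^-1).
  have zeta0 : 0 < zeta by rewrite invr_gt0 addr_gt0.
  have zeta1 : zeta <= 1 by rewrite invf_le1 ?addr_gt0// lerDl ltW.
  have vle : normc v <= 4 * (e1 * normc z).
    rewrite normcM normc_real gtr0_norm// normcM normcV.
    have : normc (exp_tail z) / normc z <= 4 * (e1 * normc z).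
      rewrite ler_pdivrMr//; apply: le_trans (normc_exp_tail2 z1) _.
      by rewrite -/e1 expr2 !mulrA.
    move=> h; apply: le_trans h; rewrite ler_piMl// divr_ge0 ?normc_ge0//.
  have v2 : normc v <= 1 / 2 by lra.
  have s0 : (1 + sigma)%:C != 0 :> C.
    by apply/eqP => -[/eqP]; rewrite gt_eqF// addr_gt0.
  have zE : zeta%:C = ((1 + sigma)%:C)^-1 :> C by rewrite fmorphV.
  have v1 : 1 - v != 0.
    rewrite -normc_gt0; have := normcB_le 1 v; rewrite normc1; lra.
  have tE : (tfun z)^-1 = zeta%:C * z^-1 * (1 - v)^-1.
    rewrite zE -!invfM; congr (_^-1); rewrite /v zE /tfun /exp_tail rmorphD rmorph1.
    by field; rewrite z0; move: s0; rewrite rmorphD rmorph1.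
  have -> : (tfun z)^-1 ^+ m.+1 + (-1 : R)%:C * P z = (zeta%:C * z^-1) ^+ m.+1 *
     ((1 - v)^-1 ^+ m.+1 - \sum_(p < m.+1) 'C((m.+1 + p).-1, p)%:R * v ^+ p).
    rewrite tE exprMn rmorphN rmorph1 mulN1r mulrBr; congr (_ - _).
    rewrite big_distrr/=; apply: eq_bigr => p _.
    rewrite /a rmorphM rmorph_nat rmorphXn !exprD !exprMn; ring.
  rewrite normcM normcX; apply: le_trans (ler_wpM2l _ (hK v v2)) _.
    by rewrite exprn_ge0 ?normc_ge0.
  rewrite mulrCA -exprMn ler_wpM2l// lerXn2r ?nnegrE ?mulr_ge0 ?normc_ge0 ?(ltW e0)//.
  rewrite normcM normcV normc_real gtr0_norm//.
  have h : zeta / normc z * normc v <= zeta / normc z * (4 * (e1 * normc z)).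
    by rewrite ler_wpM2l// divr_ge0 ?ltW.
  apply: le_trans h _.
  have -> : zeta / normc z * (4 * (e1 * normc z)) = zeta * (4 * e1).
    by field; rewrite gt_eqF.
  by rewrite ler_piMl// mulr_ge0// ltW.
have eqI : impath (fun z => (tfun z)^-1 ^+ m.+1) p0 ps =
    \sum_(p < m.+1) a p * moment (m.+1 + p) p.
  have <- : impath P p0 ps = \sum_(p < m.+1) a p * moment (m.+1 + p) p.
    exact: (@impath_sum R m.+1 a (fun p z => exp_tail z ^+ p * z^-1 ^+ (m.+1 + p))
      p0 ps (fun p => cont_moment (m.+1 + p) p)).
  move: vanish; rewrite impathD; first last.
  - by have [dF hF] := hNP; exact: holo_cont hF _ _ _.
  - by have [dF hF] := ht; exact: holo_cont hF _ _ _.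
  rewrite impathZ; last by have [dF hF] := hP; exact: holo_cont hF _ _ _.
  by rewrite mulN1r => /eqP; rewrite subr_eq0 => /eqP.
have fn0 k : (k`!%:R : R) != 0 by rewrite pnatr_eq0 -lt0n fact_gt0.
have m0 : (m.+1%:R : R) != 0 by rewrite pnatr_eq0.
have pi0 : (pi : R) != 0 by rewrite gt_eqF// pi_gt0.
rewrite eqI /coef_c big_mkord !big_distrr/=; apply: eq_bigr => p _.
rewrite /a addSn momentE/= (addnC p m.+1) addSn/= subn1/=.
rewrite -/zeta factS natrM.
have /(congr1 (fun k : nat => k%:R : R)) := bin_fact (leq_addl m p).
rewrite addnK !natrM => <-.
have b0 : ('C(m + p, p)%:R : R) != 0 by rewrite pnatr_eq0 -lt0n bin_gt0 leq_addl.
move: (pi : R) pi0 => c c0.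
by field; rewrite !fn0 b0 c0 -(natrD _ 1 m) pnatr_eq0.
Qed.

End CoefficientIntegral.

(** * A Gaussian integral over the unit interval *)

Section GaussianIntegral.
Context {R : realType}.
Local Notation mu := (@lebesgue_measure R).

Definition bell (A x : R) := expR (- (A * (x - 1 / 2) ^+ 2)).

(** This is the normal density with mean 1/2 and variance 1 / (2 A). *)
Lemma bell_integral (A : R) : 0 < A ->
  (\int[mu]_x (bell A x)%:E = (Num.sqrt (pi / A))%:E)%E.
Proof.
move=> A0; pose s := Num.sqrt ((2 * A)^-1).
have A20 : 0 < (2 * A)^-1 by rewrite invr_gt0 mulr_gt0.
have s0 : s != 0 by rewrite gt_eqF// sqrtr_gt0.
have s2 : s ^+ 2 = (2 * A)^-1 by rewrite sqr_sqrtr// ltW.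
have A00 : A != 0 by rewrite gt_eqF.
have p0 : 0 < Num.sqrt (pi / A) by rewrite sqrtr_gt0 divr_gt0// pi_gt0.
have bE x : bell A x = Num.sqrt (pi / A) * normal_pdf (1 / 2) s x.
  rewrite (normal_pdfE _ s0) /normal_peak /normal_fun s2.
  have -> : (2 * A)^-1 * pi *+ 2 = pi / A by rewrite -mulr_natr; field.
  rewrite mulrA divff ?mul1r ?gt_eqF//; congr expR.
  by rewrite -mulr_natr; field.
transitivity (\int[mu]_x ((Num.sqrt (pi / A))%:E * (normal_pdf (1 / 2) s x)%:E))%E.
  by apply: eq_integral => x _; rewrite bE EFinM.
rewrite integralZl//; last exact: integrable_normal_pdf.
by rewrite integral_normal_pdf mule1.
Qed.

Lemma continuous_bell (A x : R) : continuous_at x (bell A).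
Proof.
have c : continuous_at x (fun x => - (A * (x - 1 / 2) ^+ 2)).
  apply: cvgN; apply: cvgM; first exact: cvg_cst.
  by apply: cvgM; (apply: cvgB; [exact: cvg_id|exact: cvg_cst]).
exact: (continuous_comp c (@continuous_expR _ _)).
Qed.

Lemma I01_bell_le (A : R) : 0 < A -> I01 (bell A) <= Num.sqrt (pi / A).
Proof.
move=> A0; rewrite /I01 /Rintegral -[leRHS]/(fine (Num.sqrt (pi / A))%:E).
rewrite -(bell_integral A0); apply: fine_le.
- apply: integrable_fin_num => //.
  by apply: cont01_integrable => x _; exact: continuous_bell.
- by rewrite bell_integral.
- apply: ge0_subset_integral => //.
    apply/measurable_EFinP; apply: continuous_measurable_fun => x.
    exact: continuous_bell.
  by move=> x _; rewrite lee_fin expR_ge0.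
Qed.

(** Outside the unit interval (x - 1/2)^2 >= 1/4, so that the tail is at most
    exp(- (A - 1) / 4) times a fixed Gaussian integral, and A exp(- A / 4) <= 4. *)
Lemma I01_bell_ge (A : R) : 1 <= A ->
  Num.sqrt (pi / A) - 4 * expR (1 / 4) * Num.sqrt pi / A <= I01 (bell A).
Proof.
move=> A1; have A0 : 0 < A by lra.
have mb B : measurable_fun setT (fun x => (bell B x)%:E).
  apply/measurable_EFinP; apply: continuous_measurable_fun => x.
  exact: continuous_bell.
have b0 B x : (0 <= (bell B x)%:E)%E by rewrite lee_fin expR_ge0.
have fin01 : (\int[mu]_(x in `[0%R, 1%R]) (bell A x)%:E)%E \is a fin_num.
  apply: integrable_fin_num => //.
  by apply: cont01_integrable => x _; exact: continuous_bell.
have tail : (\int[mu]_(x in ~` `[0%R, 1%R]) (bell A x)%:E <=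
    (4 * expR (1 / 4) * Num.sqrt pi / A)%:E)%E.
  have -> : 4 * expR (1 / 4) * Num.sqrt pi / A =
    (4 * expR (1 / 4) / A) * Num.sqrt (pi / 1) by rewrite divr1; ring.
  have c0 : 0 <= 4 * expR (1 / 4) / A :> R.
    by rewrite divr_ge0 ?(ltW A0)// mulr_ge0// expR_ge0.
  rewrite EFinM -(bell_integral ltr01) -ge0_integralZl ?lee_fin//.
  apply: (@le_trans _ _ (\int[mu]_(x in ~` `[0%R, 1%R])
    ((4 * expR (1 / 4) / A)%:E * (bell 1 x)%:E))%E); last first.
    apply: ge0_subset_integral => //.
    - by apply: measurableC.
    - by apply: measurable_funeM; exact: mb.
    - by move=> x _; rewrite mule_ge0// lee_fin.
  apply: ge0_le_integral => //.
  - by apply: measurableC.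
  - by apply: measurable_funTS; exact: mb.
  - by apply: measurable_funTS; apply: measurable_funeM; exact: mb.
  - move=> x /= /negP; rewrite in_itv/= negb_and -!ltNge => h.
    rewrite -EFinM lee_fin /bell.
    have x4 : 1 / 4 <= (x - 1 / 2) ^+ 2.
      by case/orP: h => h; rewrite expr2; nra.
    have e1 : A / 4 * expR (- (A / 4)) <= 1.
      rewrite expRN ler_pdivrMr ?expR_gt0// mul1r.
      by have := expR_ge1Dx (A / 4); lra.
    have e2 : expR (- (A * (x - 1 / 2) ^+ 2)) <=
        expR (- (A / 4)) * expR (1 / 4) * expR (- (1 * (x - 1 / 2) ^+ 2)).
      by rewrite -!expRD ler_expR; nra.
    apply: le_trans e2 _; rewrite ler_wpM2r ?expR_ge0//.
    rewrite mulrAC ler_wpM2r ?expR_ge0// ler_pdivlMr//; lra.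
  - exact: mb.
have -> : Num.sqrt (pi / A) = fine ((\int[mu]_(x in `[0%R, 1%R]) (bell A x)%:E)
    + (\int[mu]_(x in ~` `[0%R, 1%R]) (bell A x)%:E)).
  rewrite -ge0_integral_setU//; [|exact: measurableC|..].
  - by rewrite setUv bell_integral.
  - by rewrite setUv; exact: mb.
  - exact/disj_setPRL.
have tfin : (\int[mu]_(x in ~` `[0%R, 1%R]) (bell A x)%:E)%E \is a fin_num.
  rewrite ge0_fin_numE ?(le_lt_trans tail) ?ltry//.
  by apply: integral_ge0 => x _.
rewrite fineD// lerBlDr /I01 /Rintegral lerD2l -lee_fin fineK//.
Qed.

End GaussianIntegral.

(** * The contribution of the saddle *)

Section SaddleLocal.
Context {R : realType}.
Local Notation C := R[i].
Variables (sigma : R) (sigma_gt0 : 0 < sigma).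
Implicit Types z w u : C.

Definition tstar : C := Complex (1 + sigma - sigma * ln sigma) (pi * sigma).

(** The critical point of [tfun] in the upper half-plane nearest to 0; its critical
    value is [tstar]. *)
Definition ystar : C := Complex (- ln sigma) pi.

(** As exp(- ystar) = - sigma, the map is reproduced around its critical point by
    exp_tail. *)
Lemma tfun_saddle w : tfun sigma (ystar + w) = tstar + sigma%:C * exp_tail w.
Proof.
rewrite /tfun opprD cexpD.
have -> : cexp (- ystar) = - sigma%:C.
  apply: complexP; rewrite /= opprK lnK ?posrE//.
    by rewrite cosN cospi mulrN1.
  by rewrite sinN sinpi oppr0 mulr0.
have -> : tstar = sigma%:C * ystar + 1 + sigma%:C.
  by apply: complexP; rewrite /= ?mul0r; ring.
rewrite /exp_tail; ring.
Qed.

Lemma tstar_neq0 : tstar != 0.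
Proof.
by apply/eqP => -[_ /eqP]; rewrite mulf_eq0 (gt_eqF sigma_gt0) (gt_eqF (pi_gt0 _)).
Qed.

Variable d : C.
Hypothesis d2 : d ^+ 2 = tstar.

Let tau := normc tstar.

Let tau_gt0 : 0 < tau. Proof. by rewrite normc_gt0 tstar_neq0. Qed.

Let e1 : R := expR 1.
Let e1_gt0 : 0 < e1. Proof. exact: expR_gt0. Qed.

(** Since d^2 = tstar and exp_tail w = w^2 / 2 + O(w^3), the direction d turns
    tfun / tstar into 1 + sigma r^2 u^2 / 2 + O(r^3). *)
Lemma local_expansion (U : R) : 0 <= U -> exists K r0 : R, [/\ 0 <= K, 0 < r0 &
  forall (r : R) u, `|r| <= r0 -> normc u <= U ->
  normc (tfun sigma (ystar + d * (r%:C * u)) / tstar - 1 - (sigma / 2 * r ^+ 2)%:C * u ^+ 2)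
    <= K * `|r| ^+ 3].
Proof.
move=> U0; have dU : 0 <= normc d * U by rewrite mulr_ge0 ?normc_ge0.
exists (sigma / tau * (8 * (e1 * (normc d * U) ^+ 3))), (normc d * U + 1)^-1; split.
- rewrite mulr_ge0 ?divr_ge0 ?(ltW tau_gt0) ?(ltW sigma_gt0)//.
  by rewrite mulr_ge0// mulr_ge0 ?(ltW e1_gt0)// exprn_ge0.
- by rewrite invr_gt0 ltr_wpDl.
move=> r u rr0 uU; set w := d * (r%:C * u).
have wle : normc w <= `|r| * (normc d * U).
  by rewrite !normcM normc_real mulrCA ler_wpM2l// ler_wpM2l ?normc_ge0.
have w1 : normc w <= 1.
  apply: le_trans wle _.
  move: rr0; rewrite -[_^-1]mul1r ler_pdivlMr; last by lra.
  have := normr_ge0 r; nra.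
have ts0 := tstar_neq0.
have -> : tfun sigma (ystar + w) / tstar - 1 - (sigma / 2 * r ^+ 2)%:C * u ^+ 2 =
    sigma%:C / tstar * (exp_tail w - w ^+ 2 / 2%:R).
  rewrite tfun_saddle !rmorphM fmorphV rmorph_nat.
  have -> : w ^+ 2 = tstar * (r%:C ^+ 2 * u ^+ 2) by rewrite /w !exprMn d2.
  by field.
rewrite normcM normcM normcV normc_real (gtr0_norm sigma_gt0).
rewrite -[leRHS]mulrA ler_wpM2l ?divr_ge0 ?(ltW sigma_gt0) ?(ltW tau_gt0)//.
apply: le_trans (normc_exp_tail3 w1) _.
have h3 : normc w ^+ 3 <= (normc d * U) ^+ 3 * `|r| ^+ 3.
  by rewrite -exprMn mulrC lerXn2r ?nnegrE ?normc_ge0 ?mulr_ge0 ?normc_ge0// mulrC.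
by have := ler_wpM2l (ltW e1_gt0) h3; rewrite -/e1; lra.
Qed.

Lemma local_lower (U c : R) : 0 <= U -> 0 < c -> exists r0 : R, 0 < r0 /\
  forall (r : R) u, `|r| <= r0 -> normc u <= U -> c <= Re (u ^+ 2) ->
  1 + sigma * c / 4 * r ^+ 2 <=
    Re (tfun sigma (ystar + d * (r%:C * u)) / tstar).
Proof.
move=> U0 c0; have [K [r0 [K0 r00 H]]] := local_expansion U0.
have sc : 0 < sigma * c by rewrite mulr_gt0.
exists (Num.min r0 (sigma * c / (4 * (K + 1)))); split.
  by rewrite lt_min r00 divr_gt0// mulr_gt0//; lra.
move=> r u; rewrite le_min => /andP[rr0 rc] uU cu.
have h := H r u rr0 uU; move: h; set a := _ / tstar; clearbody a => h.
have h2 := le_trans (ler_Re_normc _) h.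
move: h2; rewrite ler_norml => /andP[+ _].
rewrite !cReD !cReN cReZ (_ : Re 1 = 1)//.
have r2 : `|r| ^+ 3 = `|r| * r ^+ 2 by rewrite exprS real_normK ?num_real.
rewrite r2.
have kr : K * `|r| <= sigma * c / 4.
  move: rc; rewrite ler_pdivlMr; last by lra.
  by move=> rc; have := normr_ge0 r; nra.
have := sqr_ge0 r; have := ler_wpM2r (sqr_ge0 r) kr.
have := ler_wpM2l (mulr_ge0 (ltW sigma_gt0) (sqr_ge0 r)) cu.
lra.
Qed.

Lemma expR_half_le (s : R) : 0 <= s <= 1 -> expR (s / 2) <= 1 + s.
Proof.
move=> /andP[s0 s1]; have := expR_ge1Dx (- (s / 2)).
rewrite expRN => h; have e0 := expR_gt0 (s / 2).
have : (1 - s / 2) * expR (s / 2) <= 1 by rewrite -ler_pdivlMr// div1r.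
nra.
Qed.

Lemma expR_quad (s : R) : 0 <= s <= 1 -> `|expR s - 1 - s| <= 4 * (e1 * s ^+ 2).
Proof.
move=> /andP[s0 s1].
have n1 : normc ((- s)%:C : C) = s by rewrite normc_real normrN ger0_norm.
have := @normc_exp_tail2 R (- s)%:C; rewrite n1 => /(_ s1).
have -> : exp_tail (- s)%:C = (expR s - 1 - s)%:C.
  by apply: complexP; rewrite /= ?opprK oppr0 ?cos0 ?sin0; ring.
by rewrite normc_real.
Qed.

Lemma normc_subX m (a b : C) (g : R) : normc a <= g -> normc b <= g ->
  normc (a ^+ m - b ^+ m) <= m%:R * g ^+ m.-1 * normc (a - b).
Proof.
move=> ag bg; have g0 : 0 <= g by exact: le_trans (normc_ge0 _) ag.
elim: m => [|m IH]; first by rewrite !expr0 subrr normc0 !mul0r.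
have -> : a ^+ m.+1 - b ^+ m.+1 = a * (a ^+ m - b ^+ m) + (a - b) * b ^+ m.
  by rewrite !exprS; ring.
apply: le_trans (le_normcD _ _) _; rewrite !normcM normcX.
have h1 : normc a * normc (a ^+ m - b ^+ m) <= m%:R * g ^+ m * normc (a - b).
  apply: le_trans (ler_pM (normc_ge0 _) (normc_ge0 _) ag IH) _.
  case: m {IH} => [|m]; first by rewrite !mul0r mulr0.
  by rewrite /= [g ^+ m.+1]exprS; nra.
have h2 : normc (a - b) * normc b ^+ m <= normc (a - b) * g ^+ m.
  by rewrite ler_wpM2l ?normc_ge0// lerXn2r ?nnegrE ?normc_ge0.
apply: le_trans (lerD h1 h2) _.
by rewrite /= -natr1 le_eqVlt; apply/orP; left; apply/eqP; ring.
Qed.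

(** With y = s |r| this is y^3 exp(- y^2 / 2) <= 9; half of the Gaussian decay is
    kept for the integration over r. *)
Lemma cube_exp_le (s r : R) : 0 < s ->
  `|r| ^+ 3 * expR (- (s ^+ 2 * r ^+ 2)) <=
  9 / s ^+ 3 * expR (- (s ^+ 2 * r ^+ 2 / 2)).
Proof.
move=> s0; set y := s * `|r|.
have y0 : 0 <= y by rewrite mulr_ge0// ltW.
have -> : s ^+ 2 * r ^+ 2 = y ^+ 2 by rewrite exprMn real_normK ?num_real.
have -> : `|r| ^+ 3 = y ^+ 3 / s ^+ 3.
  by rewrite exprMn; field; rewrite gt_eqF.
rewrite [leRHS]mulrAC ![_ / s ^+ 3 * _]mulrAC ler_wpM2r ?invr_ge0 ?exprn_ge0 ?(ltW s0)//.
have -> : - y ^+ 2 = - (y ^+ 2 / 2) + - (y ^+ 2 / 2) by field.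
rewrite expRD mulrA ler_wpM2r ?expR_ge0// expRN ler_pdivrMr ?expR_gt0//.
have -> : y ^+ 2 / 2 = y ^+ 2 / 4 + y ^+ 2 / 4 by field.
rewrite expRD; have := expR_ge1Dx (y ^+ 2 / 4).
have y2 := sqr_ge0 y; set E := expR _ => hE.
have hEE : (1 + y ^+ 2 / 4) * (1 + y ^+ 2 / 4) <= E * E.
  by apply: ler_pM => //; lra.
have h3 : 0 <= y ^+ 2 * (1 - y) ^+ 2 by rewrite mulr_ge0 ?sqr_ge0.
have -> : y ^+ 3 = (y ^+ 2 + y ^+ 4 - y ^+ 2 * (1 - y) ^+ 2) / 2 by field.
have y4 : 0 <= y ^+ 4 by rewrite exprn_ge0.
have -> : y ^+ 4 = y ^+ 2 * y ^+ 2 by ring.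
have y4' : 0 <= y ^+ 2 * y ^+ 2 by rewrite mulr_ge0.
lra.
Qed.

(** Both tstar / tfun and exp(- sigma r^2 / 2) are at most exp(- sigma r^2 / 8) in
    modulus and differ by O(r^3); raise them to the power m with [normc_subX]. *)
Lemma saddle_pointwise : exists K r0 : R, [/\ 0 <= K, 0 < r0 &
  forall r : R, `|r| <= r0 -> forall m : nat,
  tfun sigma (ystar + d * r%:C) != 0 /\
  normc ((tstar / tfun sigma (ystar + d * r%:C)) ^+ m -
         (expR (- (sigma * r ^+ 2 / 2)))%:C ^+ m) <=
    m%:R * expR (- (sigma * r ^+ 2 / 8)) ^+ m.-1 * (K * `|r| ^+ 3)].
Proof.
have [K [r0 [K0 r00 H]]] := @local_expansion 1 ler01.
have [r1 [r10 L]] := @local_lower 1 1 ler01 ltr01.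
exists (e1 * sigma ^+ 2 + K), (Num.min r0 (Num.min r1 (Num.min 1 (2 / sigma)))).
split.
- by rewrite addr_ge0// mulr_ge0 ?sqr_ge0// ltW.
- by rewrite !lt_min r00 r10 ltr01 divr_gt0.
move=> r; rewrite !le_min => /and4P[rr0 rr1 rle1 rs] m.
have n1 : normc (1 : C) <= 1 by rewrite normc1.
have := H r 1 rr0 n1; have := L r 1 rr1 n1.
rewrite expr1n !mulr1 => /(_ (lexx _)) {}L {}H.
set t := tfun sigma _ in L H *.
have r2E : r ^+ 2 = `|r| ^+ 2 by rewrite real_normK ?num_real.
have r20 := sqr_ge0 r.
have s1 : sigma * r ^+ 2 / 2 <= 1.
  move: rs; rewrite ler_pdivlMr// => rs; rewrite r2E.
  have := normr_ge0 r; nra.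
have s0 : 0 <= sigma * r ^+ 2 by rewrite mulr_ge0// ltW.
have t0 : t != 0.
  by apply/eqP => t0; move: L; rewrite t0 mul0r/=; lra.
split=> //; set a := t / tstar in L H *.
have aE : tstar / t = a^-1 by rewrite /a invf_div.
have na : expR (sigma * r ^+ 2 / 8) <= normc a.
  have h1 : expR (sigma * r ^+ 2 / 4 / 2) <= 1 + sigma * r ^+ 2 / 4.
    by apply: expR_half_le; apply/andP; split; lra.
  have -> : sigma * r ^+ 2 / 8 = sigma * r ^+ 2 / 4 / 2 by field.
  apply: le_trans h1 _; apply: le_trans (ler_Re_normc a).
  by apply: le_trans (ler_norm _); lra.
set g := expR (- (sigma * r ^+ 2 / 8)).
have g1 : g <= 1 by rewrite /g -[leRHS]expR0 ler_expR; lra.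
have ag : normc a^-1 <= g.
  by rewrite normcV /g expRN lef_pV2 ?posrE ?expR_gt0// (lt_le_trans (expR_gt0 _) na).
set b := expR (- (sigma * r ^+ 2 / 2)).
have b0 : 0 < b by exact: expR_gt0.
have nb : normc (b%:C : C) = b by rewrite normc_real gtr0_norm.
have bg : normc (b%:C : C) <= g by rewrite nb ler_expR; lra.
rewrite aE; apply: le_trans (normc_subX m ag bg) _.
rewrite ler_wpM2l//; first by rewrite mulr_ge0// exprn_ge0// expR_ge0.
have a0 : a != 0 by rewrite -normc_gt0 (lt_le_trans (expR_gt0 _) na).
have bC : (b%:C : C) != 0 by rewrite -normc_gt0 nb.
have -> : a^-1 - b%:C = a^-1 * b%:C * ((b^-1)%:C - a).
  by rewrite fmorphV; field; rewrite a0 bC.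
have h : normc ((b^-1)%:C - a) <= (e1 * sigma ^+ 2 + K) * `|r| ^+ 3.
  have -> : (b^-1)%:C - a = (b^-1 - 1 - sigma * r ^+ 2 / 2)%:C -
      (a - 1 - (sigma / 2 * r ^+ 2)%:C).
    have -> : sigma / 2 * r ^+ 2 = sigma * r ^+ 2 / 2 by ring.
    by rewrite !rmorphB rmorph1; ring.
  apply: le_trans (le_normcD _ _) _; rewrite normcN normc_real mulrDl lerD//.
  rewrite /b -expRN opprK; apply: le_trans (expR_quad _) _.
    by apply/andP; split; lra.
  have -> : 4 * (e1 * (sigma * r ^+ 2 / 2) ^+ 2) = e1 * sigma ^+ 2 * (r ^+ 2 * r ^+ 2).
    by field.
  apply: ler_wpM2l; first by rewrite mulr_ge0 ?sqr_ge0// ltW.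
  rewrite r2E -exprD.
  by rewrite (_ : (2 + 2 = 3.+1)%N)// exprS ler_piMl// exprn_ge0.
rewrite normcM; apply: le_trans h; rewrite -[leRHS]mul1r ler_wpM2r ?normc_ge0//.
rewrite normcM mulr_ile1 ?normc_ge0//; first exact: le_trans g1.
exact: le_trans g1.
Qed.

(** The limit of sqrt m * tau^m times the integral across the saddle. *)
Definition saddle_const m : R :=
  Num.sqrt (2 * pi / sigma) * Im (- (d * (tau%:C / tstar) ^+ m)).

(** On the segment, parametrized by x in the unit interval, r = e (1 - 2 x), so that
    exp(- sigma r^2 / 2)^m is a bell function centred at 1/2 with A = 2 e^2 sigma m.
    Replacing the integrand by it costs m * (m^(-1/2))^3 * m^(-1/2) = 1 / m, and
    the tails of the bell cost 1 / A. *)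
Lemma saddle_asym : exists r0 : R, 0 < r0 /\ forall e : R, 0 < e <= r0 ->
  exists (K : R) (m0 : nat), forall m : nat, (m0 <= m)%N ->
  `|Num.sqrt m%:R * tau ^+ m *
      imint (fun z => (tfun sigma z)^-1 ^+ m) (ystar + d * e%:C) (ystar - d * e%:C)
    - saddle_const m| <= K / Num.sqrt m%:R.
Proof.
have [K [r0 [K0 r00 H]]] := saddle_pointwise.
exists r0; split=> // e /andP[e0 er0].
pose r (x : R) := e * (1 - 2 * x).
have rle x : x \in `[0, 1] -> `|r x| <= r0.
  rewrite in_itv/= => /andP[x0 x1]; apply: le_trans er0.
  by rewrite normrM (gtr0_norm e0) ler_piMr ?(ltW e0)// ler_norml; lra.
have segE x : seg (ystar + d * e%:C) (ystar - d * e%:C) x = ystar + d * (r x)%:C.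
  rewrite /seg /r rmorphM rmorphB rmorphM rmorph1 rmorph_nat; ring.
have dE : (ystar - d * e%:C) - (ystar + d * e%:C) = - (2 * e)%:C * d.
  by rewrite rmorphM rmorph_nat; ring.
pose F (m : nat) z := (tfun sigma z)^-1 ^+ m.
have cF m p q : onseg (fun z => tfun sigma z != 0) p q -> onseg (cont_at (F m)) p q.
  move=> pq; have [dF hF] : holomorphic (fun z => tfun sigma z != 0) (F m).
    by apply/holomorphicX/holomorphicV => //; exact: holomorphic_tfun.
  by move=> x x01; have [] := hF _ (pq x x01).
have nz : onseg (fun z => tfun sigma z != 0) (ystar + d * e%:C) (ystar - d * e%:C).
  by move=> x x01; rewrite segE; have [] := H _ (rle x x01) 0%N.
pose c4 : R := 4 * expR (1 / 4) * Num.sqrt pi.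
pose C1 := 18 * K * normc d * Num.sqrt (pi / 2) * 256 / sigma ^+ 2.
pose C2 := normc d * c4 / (e * sigma).
exists (C1 + C2), (maxn 2 (Num.bound (2 * e ^+ 2 * sigma)^-1)) => m.
rewrite geq_max => /andP[m2 mb].
have es0 : 0 < 2 * e ^+ 2 * sigma by rewrite !mulr_gt0// exprn_gt0.
have m2R : 2 <= m%:R :> R by rewrite ler_nat.
have m0R : 0 < m%:R :> R by lra.
pose A := 2 * e ^+ 2 * sigma * m%:R.
have A1 : 1 <= A.
  rewrite /A -ler_pdivrMl// mulr1; apply: ltW.
  have /archi_boundP h : 0 <= (2 * e ^+ 2 * sigma)^-1 by rewrite invr_ge0 ltW.
  by apply: lt_le_trans h _; rewrite ler_nat.
pose s := Num.sqrt (sigma * (m%:R - 1) / 8).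
have s2 : s ^+ 2 = sigma * (m%:R - 1) / 8.
  by rewrite sqr_sqrtr// divr_ge0// mulr_ge0 ?(ltW sigma_gt0)//; lra.
have s0 : 0 < s.
  by rewrite sqrtr_gt0 divr_gt0// mulr_gt0//; lra.
pose A' := 2 * s ^+ 2 * e ^+ 2.
have A'0 : 0 < A' by rewrite !mulr_gt0// exprn_gt0.
pose W := - (d * (tau%:C / tstar) ^+ m).
have nW : normc W = normc d.
  rewrite normcN normcM normcX normcM normcV normc_real (gtr0_norm tau_gt0).
  by rewrite divff ?gt_eqF// expr1n mulr1.
have ts0 := tstar_neq0.
have tauC : (tau%:C : C) != 0 by rewrite -normc_gt0 normc_real gtr0_norm.
pose f x := tau ^+ m * Im (F m (seg (ystar + d * e%:C) (ystar - d * e%:C) x) *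
  ((ystar - d * e%:C) - (ystar + d * e%:C))).
have cf0 := cont_at_seg (cF m _ _ nz).
have cf : cont01 f.
  move=> x x01; apply: cvgM; first exact: cvg_cst.
  exact: cf0.
have fE x : f x = Im ((tstar / tfun sigma (ystar + d * (r x)%:C)) ^+ m * ((2 * e)%:C * W)).
  rewrite /f -cImZ segE dE rmorphXn /F /W !exprMn; congr Im.
  set T := (tfun _ _)^-1 ^+ m.
  have : tstar^-1 ^+ m * tstar ^+ m = 1 by rewrite -exprMn mulVf ?expr1n.
  set X := tstar^-1 ^+ m; set Y := tstar ^+ m; set Z := tau%:C ^+ m => XY.
  transitivity (Z * (T * (- (2 * e)%:C * d)) * (X * Y)); first by rewrite XY mulr1.
  ring.
have bE x : expR (- (sigma * r x ^+ 2 / 2)) ^+ m = bell A x.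
  by rewrite -expRM_natl /bell /A /r; congr expR; field.
have gE x : expR (- (sigma * r x ^+ 2 / 8)) ^+ m.-1 = expR (- (s ^+ 2 * r x ^+ 2)).
  have m1 : m.-1%:R = m%:R - 1 :> R.
    by rewrite -[in RHS](ltn_predK m2) -natr1 addrK.
  by rewrite -expRM_natl s2 m1; congr expR; field.
have b'E x : expR (- (s ^+ 2 * r x ^+ 2 / 2)) = bell A' x.
  by rewrite /bell /A' /r; congr expR; field.
have cb B c : cont01 (fun x => c * bell B x).
  by move=> x _; apply: cvgM; [exact: cvg_cst|exact: continuous_bell].
have err1 : `|I01 f - 2 * e * Im W * I01 (bell A)| <=
    m%:R * K * (2 * e * normc d) * (9 / s ^+ 3) * I01 (bell A').
  rewrite -!I01Z; [|by move=> x _; exact: continuous_bell..].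
  rewrite -I01B; [|exact: cf|exact: cb].
  apply: I01_norm_le.
  - by move=> x x01; apply: cvgB; [exact: cf|exact: cb].
  - exact: cb.
  - move=> x x01; rewrite fE -bE.
    have [_ hx] := H _ (rle x x01) m.
    set a := tstar / _ in hx *; set b := expR (- (sigma * r x ^+ 2 / 2)) in hx *.
    have -> : Im (a ^+ m * ((2 * e)%:C * W)) - 2 * e * Im W * b ^+ m =
        Im ((a ^+ m - b%:C ^+ m) * ((2 * e)%:C * W)).
      rewrite [RHS](_ : _ = Im (a ^+ m * ((2 * e)%:C * W) - (b ^+ m * (2 * e))%:C * W)).
        by rewrite [in RHS]cImD [in RHS]cImN [in RHS]cImZ; ring.
      by rewrite (rmorphM _ (b ^+ m)) rmorphXn; congr Im; ring.
    apply: le_trans (ler_Im_normc _) _.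
    rewrite normcM [normc (_ * W)]normcM normc_real nW ger0_norm; last first.
      by rewrite mulr_ge0// ltW.
    have ed0 : 0 <= 2 * e * normc d by rewrite mulr_ge0 ?normc_ge0 ?mulr_ge0// ltW.
    apply: le_trans (ler_wpM2r ed0 hx) _; rewrite gE.
    have := cube_exp_le (r x) s0; rewrite b'E => hc.
    have mk0 : 0 <= m%:R * K * (2 * e * normc d) by apply: mulr_ge0 => //; apply: mulr_ge0.
    by have := ler_wpM2l mk0 hc; lra.
have e00 : e != 0 by rewrite gt_eqF.
have s00 : s != 0 by rewrite gt_eqF.
have sg0 : sigma != 0 by rewrite gt_eqF.
have sm0 : 0 < Num.sqrt m%:R :> R by rewrite sqrtr_gt0.
have smE : Num.sqrt m%:R ^+ 2 = m%:R :> R by rewrite sqr_sqrtr// ltW.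
have sqA' : Num.sqrt (pi / A') = Num.sqrt (pi / 2) / (s * e).
  have -> : pi / A' = pi / 2 * ((s * e)^-1) ^+ 2.
    by move: (pi : R) => P; rewrite /A'; field; rewrite s00 e00.
  rewrite sqrtrM ?divr_ge0 ?pi_ge0// sqrtr_sqr gtr0_norm// invr_gt0 mulr_gt0//.
have sqA : Num.sqrt (pi / A) = Num.sqrt (2 * pi / sigma) / (2 * e * Num.sqrt m%:R).
  have -> : pi / A = 2 * pi / sigma * ((2 * e * Num.sqrt m%:R)^-1) ^+ 2.
    rewrite exprVn exprMn smE /A; move: (pi : R) => P.
    by field; rewrite sg0 e00 gt_eqF.
  rewrite sqrtrM ?divr_ge0 ?mulr_ge0 ?pi_ge0 ?(ltW sigma_gt0)// sqrtr_sqr gtr0_norm//.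
  by rewrite invr_gt0 !mulr_gt0.
have err1' : m%:R * K * (2 * e * normc d) * (9 / s ^+ 3) * I01 (bell A') <= C1 / m%:R.
  have k0 : 0 <= m%:R * K * (2 * e * normc d) * (9 / s ^+ 3).
    rewrite mulr_ge0// ?divr_ge0 ?exprn_ge0 ?(ltW s0)//.
    by rewrite !mulr_ge0 ?normc_ge0 ?(ltW e0).
  apply: le_trans (ler_wpM2l k0 (I01_bell_le A'0)) _; rewrite sqA'.
  have -> : m%:R * K * (2 * e * normc d) * (9 / s ^+ 3) * (Num.sqrt (pi / 2) / (s * e)) =
     18 * K * normc d * Num.sqrt (pi / 2) * (m%:R / (s ^+ 2 * s ^+ 2)).
    by field; rewrite s00 e00.
  have -> : C1 / m%:R = 18 * K * normc d * Num.sqrt (pi / 2) * (256 / sigma ^+ 2 / m%:R).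
    by rewrite /C1; field; rewrite sg0 gt_eqF.
  apply: ler_wpM2l; first by rewrite !mulr_ge0 ?normc_ge0 ?sqrtr_ge0.
  have m1 : 0 < m%:R - 1 :> R by rewrite subr_gt0 ltr1n.
  have -> : m%:R / (s ^+ 2 * s ^+ 2) = 64 / sigma ^+ 2 * (m%:R / (m%:R - 1) ^+ 2).
    by rewrite s2; field; rewrite sg0 gt_eqF.
  have -> : 256 / sigma ^+ 2 / m%:R = 64 / sigma ^+ 2 * (4 / m%:R).
    by field; rewrite sg0 gt_eqF.
  apply: ler_wpM2l; first by rewrite divr_ge0// sqr_ge0.
  rewrite ler_pdivrMr ?exprn_gt0// mulrAC ler_pdivlMr//; nra.
have err2 : `|2 * e * Im W * (I01 (bell A) - Num.sqrt (pi / A))| <= C2 / m%:R.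
  have A0 : 0 < A by exact: lt_le_trans A1.
  have h : `|I01 (bell A) - Num.sqrt (pi / A)| <= c4 / A.
    have c40 : 0 <= c4 / A.
      by rewrite divr_ge0 ?(ltW A0)// !mulr_ge0 ?expR_ge0 ?sqrtr_ge0.
    rewrite ler_distl (I01_bell_ge A1)/=.
    by apply: le_trans (I01_bell_le A0) _; rewrite lerDl.
  have hW : `|2 * e * Im W| <= 2 * e * normc d.
    rewrite normrM ger0_norm ?mulr_ge0 ?(ltW e0)//.
    by rewrite ler_wpM2l ?mulr_ge0 ?(ltW e0)// -nW ler_Im_normc.
  rewrite normrM; apply: le_trans (ler_pM _ _ hW h) _ => //.
  rewrite le_eqVlt; apply/orP; left; apply/eqP.
  by rewrite /C2 /A; field; rewrite sg0 e00 gt_eqF.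
have intE : tau ^+ m * imint (F m) (ystar + d * e%:C) (ystar - d * e%:C) = I01 f.
  by rewrite -I01Z.
rewrite -mulrA intE.
have -> : saddle_const m = Num.sqrt m%:R * (2 * e * Im W * Num.sqrt (pi / A)).
  by rewrite sqA /saddle_const -/W; field; rewrite e00 gt_eqF.
rewrite -mulrBr normrM (gtr0_norm sm0).
have -> : (C1 + C2) / Num.sqrt m%:R = Num.sqrt m%:R * ((C1 + C2) / m%:R).
  by rewrite -{3}smE; field; rewrite gt_eqF.
apply: ler_wpM2l; first exact: ltW.
have -> : I01 f - 2 * e * Im W * Num.sqrt (pi / A) =
  (I01 f - 2 * e * Im W * I01 (bell A)) +
  2 * e * Im W * (I01 (bell A) - Num.sqrt (pi / A)) by ring.
apply: le_trans (ler_normD _ _) _; rewrite [leRHS]mulrDl; apply: lerD => //.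
exact: le_trans err1 err1'.
Qed.

(** By compactness |tfun| >= rho > tau on the segment, and (tau / rho)^m = O(1 / m). *)
Lemma off_saddle p q : onseg (fun z => tau < normc (tfun sigma z)) p q ->
  exists K : R, forall m : nat, (0 < m)%N ->
  `|Num.sqrt m%:R * tau ^+ m * imint (fun z => (tfun sigma z)^-1 ^+ m) p q|
    <= K / Num.sqrt m%:R.
Proof.
move=> h.
have [dt ht] := holomorphic_tfun sigma (fun _ => True).
have [|c c01 hc] := @EVT_min R (fun x => normc (tfun sigma (seg p q x)) ^+ 2) 0 1 ler01.
  apply: continuous_in_subspaceT => x _; apply: continuous_normc_sqr.
  have [_ ct _] := ht (seg p q x) I; apply: ct (erefl _) _.
  exact: ccont_seg.
pose rho := normc (tfun sigma (seg p q c)).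
have rt : tau < rho by exact: h.
have rho0 : 0 < rho by exact: lt_trans rt.
have nz x : x \in `[0, 1] -> tfun sigma (seg p q x) != 0.
  by move=> /h; rewrite -normc_gt0; exact: lt_trans.
pose delta := rho / tau - 1.
have d0 : 0 < delta by rewrite subr_gt0 ltr_pdivlMr// mul1r.
exists (normc (q - p) / delta) => m m0.
have m0R : 0 < m%:R :> R by rewrite ltr0n.
have sm0 : 0 < Num.sqrt m%:R :> R by rewrite sqrtr_gt0.
have smE : Num.sqrt m%:R ^+ 2 = m%:R :> R by rewrite sqr_sqrtr// ltW.
have hI : `|imint (fun z => (tfun sigma z)^-1 ^+ m) p q| <= rho^-1 ^+ m * normc (q - p).
  apply: imint_norm_le.
    have [dF hF] : holomorphic (fun z => tfun sigma z != 0) (fun z => (tfun sigma z)^-1 ^+ m).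
      by apply/holomorphicX/holomorphicV => //; exact: holomorphic_tfun.
    by move=> x x01; have [] := hF _ (nz x x01).
  move=> x x01; rewrite normcX normcV lerXn2r ?nnegrE ?invr_ge0 ?normc_ge0//.
  rewrite lef_pV2 ?posrE ?normc_gt0 ?nz//.
  by rewrite -(ler_pXn2r (n := 2)) ?nnegrE ?normc_ge0// hc.
have tr : tau ^+ m * rho^-1 ^+ m <= (m%:R * delta)^-1.
  have -> : tau ^+ m * rho^-1 ^+ m = ((1 + delta) ^+ m)^-1.
    by rewrite -exprMn -exprVn /delta addrC subrK invf_div.
  rewrite lef_pV2 ?posrE ?mulr_gt0// ?exprn_gt0//; last by lra.
  have : 1 + m%:R * delta <= (1 + delta) ^+ m.
    elim: (m) => [|k IH]; first by rewrite mul0r addr0 expr0.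
    rewrite exprS -natr1; have k0 : 0 <= k%:R :> R by [].
    have : (1 + delta) * (1 + k%:R * delta) <= (1 + delta) * (1 + delta) ^+ k.
      by rewrite ler_wpM2l//; lra.
    by have := mulr_ge0 k0 (sqr_ge0 delta); lra.
  lra.
rewrite !normrM (gtr0_norm sm0) (ger0_norm (exprn_ge0 _ (ltW tau_gt0))).
have t0 : 0 <= Num.sqrt m%:R * tau ^+ m by rewrite mulr_ge0 ?exprn_ge0 ?ltW.
apply: le_trans (ler_wpM2l t0 hI) _.
have -> : Num.sqrt m%:R * tau ^+ m * (rho^-1 ^+ m * normc (q - p)) =
   (tau ^+ m * rho^-1 ^+ m) * (Num.sqrt m%:R * normc (q - p)) by ring.
have t1 : 0 <= Num.sqrt m%:R * normc (q - p) by rewrite mulr_ge0 ?normc_ge0 ?ltW.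
apply: le_trans (ler_wpM2r t1 tr) _.
rewrite le_eqVlt; apply/orP; left; apply/eqP.
move: sm0 smE; move: (Num.sqrt m%:R) => sm sm0 <-.
by field; rewrite !gt_eqF.
Qed.

End SaddleLocal.

(** * Zero-free regions and modulus estimates *)

Section ZeroFree.
Context {R : realType}.
Local Notation C := R[i].
Variables (sigma : R) (sigma_gt0 : 0 < sigma).
Implicit Types z w p q : C.

Local Notation tau := (normc (tstar sigma)).
Local Notation ystar := (ystar sigma).
Local Notation tfun := (tfun sigma).
Local Notation regular := (regular sigma).
Local Notation x0 := (- ln sigma).

Lemma Im_tfun z : Im (tfun z) = sigma * Im z + expR (- Re z) * sin (Im z).
Proof.
by rewrite /tfun !cImD cImZ cImN /= cReN cImN sinN mulrN opprK addr0.
Qed.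

Lemma Re_tfun z : Re (tfun z) = sigma * Re z + 1 - expR (- Re z) * cos (Im z).
Proof. by rewrite /tfun !cReD cReZ cReN /= cReN cImN cosN. Qed.

Lemma sin_le_id (x : R) : 0 <= x -> sin x <= x.
Proof.
rewrite le_eqVlt => /predU1P[<-|x_gt0]; first by rewrite sin0.
have df (y : R) : y \in `]0, x[ -> is_derive y 1 (@sin R) (cos y).
  by move=> _; exact: is_derive_sin.
have [c _] := MVT x_gt0 df (continuous_subspaceT (@continuous_sin R)).
rewrite sin0 !subr0 => ->; rewrite -[leRHS]mul1r ler_wpM2r ?(ltW x_gt0)//.
Qed.

(** Points whose dilations towards 0 meet neither 0 nor the zeros of [tfun]. *)
Definition star_regular z := forall s : R, 0 < s <= 1 -> regular (s%:C * z).

Let ImP_regular z : 0 < Im z -> 0 < Im (tfun z) -> regular z.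
Proof. by move=> h1 h2; split; apply/eqP => h; rewrite h ltxx in h1 h2. Qed.

Lemma star_regular_real z : Im z = 0 -> Re z != 0 -> star_regular z.
Proof.
move=> z0 z1 s /andP[s0 s1].
have sz : s * Re z != 0 by rewrite mulf_neq0// gt_eqF.
have n0 : s%:C * z != 0.
  by apply: contraNneq sz => h; rewrite -cReZ h.
split=> //; apply/eqP => /(congr1 (@Re R)); rewrite Re_tfun cReZ cImZ z0 mulr0 cos0 mulr1/=.
set x := s * Re z in sz *; move=> h.
have [xlt|xgt|xe] := ltgtP x 0; last by rewrite xe eqxx in sz.
  have : 1 <= expR (- x) by rewrite -[leLHS]expR0 ler_expR; lra.
  have : sigma * x < 0 by rewrite pmulr_rlt0.
  lra.
have : expR (- x) <= 1 by rewrite -[leRHS]expR0 ler_expR; lra.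
have : 0 < sigma * x by rewrite mulr_gt0.
lra.
Qed.

(** In the strip Im z <= pi both terms of Im (tfun z) = sigma y + exp(- x) sin y are
    nonnegative; slightly above it, sin y >= - (y - pi) still lets the first one win. *)
Lemma star_regular_near z : 0 < Im z -> expR `|Re z| * (Im z - pi) <= sigma * pi ->
  star_regular z.
Proof.
move=> b0 h s /andP[s0 s1].
apply: ImP_regular; rewrite ?Im_tfun cImZ ?cReZ ?mulr_gt0//.
set y := s * Im z; have y0 : 0 < y by rewrite mulr_gt0.
have sy : 0 < sigma * y by rewrite mulr_gt0.
have e0 := expR_gt0 (- (s * Re z)).
have [ypi|piy] := leP y pi.
  by rewrite ltr_pwDl// mulr_ge0 ?(ltW e0)// sin_ge0_pi// (ltW y0).
have yb : y <= Im z by rewrite /y ler_piMl// ltW.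
have sin_y : - (y - pi) <= sin y.
  rewrite -[in leRHS](subrK pi y) sinDpi lerN2; apply: sin_le_id.
  by rewrite subr_ge0 ltW.
have ez : expR (- (s * Re z)) <= expR `|Re z|.
  rewrite ler_expR; apply: le_trans (ler_norm _) _.
  by rewrite normrN normrM gtr0_norm// ler_piMl.
have h1 := ler_wpM2l (ltW e0) sin_y.
have h2 : expR (- (s * Re z)) * (y - pi) <= expR `|Re z| * (Im z - pi).
  by apply: ler_pM; rewrite ?expR_ge0//; lra.
have : sigma * pi < sigma * y by rewrite ltr_pM2l.
lra.
Qed.

Lemma star_regular_strip z : 0 < Im z <= pi -> star_regular z.
Proof.
move=> /andP[h1 h2]; apply: star_regular_near => //.
apply: (@le_trans _ _ 0); last by rewrite mulr_ge0 ?pi_ge0// ltW.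
by rewrite mulr_ge0_le0 ?expR_ge0// subr_le0.
Qed.

(** To the right of the saddle exp(- x) <= sigma, whence
    Im (tfun z) >= sigma (y - 1) above the strip.  The condition on the saddle
    keeps the dilations of z to its right. *)
Lemma star_regular_right z : x0 <= 0 -> 0 < Im z -> x0 <= Re z -> star_regular z.
Proof.
move=> x00 b0 xz s /andP[s0 s1].
apply: ImP_regular; rewrite ?Im_tfun cImZ ?cReZ ?mulr_gt0//.
set y := s * Im z; have y0 : 0 < y by rewrite mulr_gt0.
have sy : 0 < sigma * y by rewrite mulr_gt0.
have e0 := expR_gt0 (- (s * Re z)).
have [ypi|piy] := leP y pi.
  by rewrite ltr_pwDl// mulr_ge0 ?(ltW e0)// sin_ge0_pi// (ltW y0).
have ez : expR (- (s * Re z)) <= sigma.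
  rewrite -[leRHS]lnK ?posrE// ler_expR.
  have : s * x0 <= s * Re z by rewrite ler_wpM2l// ltW.
  nra.
have := sin_geN1 y => sN; have h1 := ler_wpM2l (ltW e0) sN.
have : 1 < y by have := @pi_ge2 R; lra.
move=> y1; have : sigma * 1 < sigma * y by rewrite ltr_pM2l.
lra.
Qed.

Lemma star_regular_sweep p q : onseg star_regular p q -> sweep regular p q.
Proof. by move=> h s x s01 x01; exact: h. Qed.

Lemma star_regular_disc : exists delta : R, 0 < delta /\ forall w, normc w <= delta ->
  star_regular (ystar + w) /\ 0 < Im (ystar + w).
Proof.
pose E := expR (`|x0| + 1).
have E0 : 0 < E by exact: expR_gt0.
have pi0 := pi_gt0 R.
exists (Num.min 1 (sigma * pi / E)); split.
  by rewrite lt_min ltr01 divr_gt0// mulr_gt0.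
move=> w; rewrite le_min => /andP[w1]; rewrite ler_pdivlMr// => w2.
have hI := ler_Im_normc w; have hR := ler_Re_normc w.
move: (hI); rewrite ler_norml => /andP[i1 i2].
have b0 : 0 < Im (ystar + w) by rewrite cImD/=; have := @pi_ge2 R; lra.
split=> //; apply: star_regular_near => //.
rewrite cImD cReD/= addrAC subrr add0r.
apply: le_trans w2; rewrite mulrC.
have e1 : expR `|x0 + Re w| <= E.
  by rewrite ler_expR; apply: le_trans (ler_normD _ _) _; rewrite lerD2l; lra.
apply: (@le_trans _ _ (normc w * expR `|x0 + Re w|)).
  by rewrite ler_wpM2r ?expR_ge0.
by rewrite ler_wpM2l ?normc_ge0.
Qed.

End ZeroFree.

Section Modulus.
Context {R : realType}.
Local Notation C := R[i].
Variables (sigma : R) (sigma_gt0 : 0 < sigma).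
Implicit Types z w p q u : C.

Local Notation tau := (normc (tstar sigma)).
Local Notation ystar := (ystar sigma).
Local Notation h0 := (1 + sigma - sigma * ln sigma).

Definition high z := tau < normc (tfun sigma z).

Lemma Re_exp_tail w : Re (exp_tail w) = expR (- Re w) * cos (Im w) - 1 + Re w.
Proof. by rewrite /exp_tail !cReD cReN /= cReN cImN cosN. Qed.

Lemma Im_exp_tail w : Im (exp_tail w) = Im w - expR (- Re w) * sin (Im w).
Proof. by rewrite /exp_tail !cImD cImN /= cReN cImN sinN; ring. Qed.

(** First-order condition: |a + b|^2 >= |a|^2 + 2 Re (b conj a), applied to the
    critical value a and the increment b = sigma exp_tail w. *)
Lemma high_ascent w : 0 < h0 * Re (exp_tail w) + pi * sigma * Im (exp_tail w) ->
  high (ystar + w).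
Proof.
move=> h; rewrite /high tfun_saddle// -(ltr_pXn2r (n := 2)) ?nnegrE ?normc_ge0//.
rewrite !normc_sqr !cReD !cImD cReZ cImZ /=.
have h1 := mulr_gt0 sigma_gt0 h.
have := sqr_ge0 (sigma * Re (exp_tail w)); have := sqr_ge0 (sigma * Im (exp_tail w)).
lra.
Qed.

Lemma high_horizontal w : 0 < h0 -> Im w = 0 -> Re w != 0 -> high (ystar + w).
Proof.
move=> h00 w0 w1; apply: high_ascent.
rewrite Re_exp_tail Im_exp_tail w0 sin0 cos0 mulr0 mulr1 subr0 mulr0 addr0 mulr_gt0//.
have := @expR_gt1Dx R (- Re w); rewrite oppr_eq0 => /(_ w1); lra.
Qed.

Lemma high_right w : 0 <= Re w -> tau < h0 + sigma * (Re w - 2) ->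
  high (ystar + w).
Proof.
move=> w0 h; rewrite /high tfun_saddle//; apply: lt_le_trans h _.
apply: le_trans (ler_Re_normc _); apply: le_trans (ler_norm _).
rewrite cReD cReZ Re_exp_tail /= lerD2l ler_wpM2l ?(ltW sigma_gt0)//.
have e0 := expR_gt0 (- Re w).
have e1 : expR (- Re w) <= 1 by rewrite -[leRHS]expR0 ler_expR; lra.
have := ler_wpM2l (ltW e0) (cos_geN1 (Im w)); lra.
Qed.

Lemma high_top w : 0 <= Re w -> tau < pi * sigma + sigma * (Im w - 1) ->
  high (ystar + w).
Proof.
move=> w0 h; rewrite /high tfun_saddle//; apply: lt_le_trans h _.
apply: le_trans (ler_Im_normc _); apply: le_trans (ler_norm _).
rewrite cImD cImZ Im_exp_tail /= lerD2l ler_wpM2l ?(ltW sigma_gt0)//.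
have e0 := expR_gt0 (- Re w).
have e1 : expR (- Re w) <= 1 by rewrite -[leRHS]expR0 ler_expR; lra.
have := ler_wpM2l (ltW e0) (sin_le1 (Im w)); lra.
Qed.

(** On the ray b (k + i), with a = k b <= 1, one has Re exp_tail <= a^2 and
    Im exp_tail >= a b / 2 = a^2 / (2 k): for small k the imaginary part wins over the
    negative h0. *)
Lemma high_slanted (k b : R) : 0 < k -> 0 < b -> k * b <= 1 ->
  2 * k * (- h0) < pi * sigma ->
  h0 <= 0 -> high (ystar + b%:C * Complex k 1).
Proof.
move=> k0 b0 kb hk h00; apply: high_ascent.
rewrite Re_exp_tail Im_exp_tail cReZ cImZ /= mulr1.
set a := b * k; have a0 : 0 < a by rewrite mulr_gt0.
have a1 : a <= 1 by rewrite /a mulrC.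
have e0 := expR_gt0 (- a).
have ea : expR (- a) * (1 + a) <= 1.
  by rewrite expRN mulrC ler_pdivrMr ?expR_gt0// mul1r expR_ge1Dx.
have gR : expR (- a) * cos b - 1 + a <= a ^+ 2.
  have := ler_wpM2l (ltW e0) (cos_le1 b).
  have : expR (- a) <= 1 - a + a ^+ 2.
    have : expR (- a) * (1 + a) <= (1 - a + a ^+ 2) * (1 + a).
      apply: le_trans ea _; have := exprn_ge0 3 (ltW a0).
      by rewrite !exprS expr0; lra.
    by rewrite ler_pM2r//; lra.
  lra.
have gI : a * b / 2 <= b - expR (- a) * sin b.
  have := ler_wpM2l (ltW e0) (sin_le_id (ltW b0)).
  have : expR (- a) <= 1 - a / 2.
    have : expR (- a) * (1 + a) <= (1 - a / 2) * (1 + a).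
      apply: le_trans ea _; have : 0 <= a * (1 - a) by rewrite mulr_ge0//; lra.
      lra.
    by rewrite ler_pM2r//; lra.
  by move=> h; have := ler_wpM2r (ltW b0) h; lra.
have ps0 : 0 < pi * sigma by rewrite mulr_gt0 ?pi_gt0.
have h1 := ler_wnM2l h00 gR; have h2 := ler_wpM2l (ltW ps0) gI.
have aE : a ^+ 2 = k * (a * b) by rewrite /a; ring.
have ab0 : 0 < a * b by rewrite mulr_gt0.
have h3 : 2 * k * (- h0) * (a * b) < pi * sigma * (a * b) by rewrite ltr_pM2r.
rewrite aE in h1.
move: h1 h2 h3; set X := pi * sigma; lra.
Qed.

(** The derivative exp(y) (cos y - sin y) of the left-hand side is decreasing, hence
    at most 1. *)
Lemma cos_expR_le (a : R) : 0 <= a <= pi / 2 -> expR a * cos a <= 1 + a.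
Proof.
move=> /andP[]; rewrite le_eqVlt => /predU1P[<- _|a0 a1].
  by rewrite expR0 cos0 mulr1 addr0.
have d1 (y : R) : is_derive y 1 (fun y : R => expR y * cos y) (expR y * (cos y - sin y)).
  by apply: is_derive_eq; rewrite /GRing.scale/=; ring.
have d2 (y : R) : is_derive y 1 (fun y : R => expR y * (cos y - sin y))
    (- (2 * expR y * sin y)).
  by apply: is_derive_eq; rewrite /GRing.scale/=; ring.
have cont (f g : R -> R) : (forall y : R, is_derive y 1 f (g y)) ->
    forall c, {within `[0, c], continuous f}.
  move=> fg c; apply: continuous_subspaceT => y.
  by have [/derivable1_diffP/differentiable_continuous] := fg y.
have [c cI] := MVT a0 (fun y _ => d1 y) (cont _ _ d1 a).
move: cI; rewrite in_itv/= => /andP[c0 ca].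
have [e eI] := MVT c0 (fun y _ => d2 y) (cont _ _ d2 c).
move: eI; rewrite in_itv/= => /andP[e0 ec].
rewrite !expR0 !cos0 !sin0 !subr0 !mulr1 => h1 h2.
have s0 : 0 <= sin e by apply: sin_ge0_pi; have := pi_gt0 R; lra.
have h3 : 0 <= 2 * expR e * sin e * c.
  by rewrite !mulr_ge0 ?expR_ge0 ?(ltW c0).
have h4 : expR c * (cos c - sin c) <= 1 by lra.
have := ler_wpM2r (ltW a0) h4; lra.
Qed.

(** The derivative exp(y) (sin y + cos y) of the right-hand side exceeds 1. *)
Lemma sin_expR_gt (a : R) : 0 < a <= pi / 2 -> a < expR a * sin a.
Proof.
move=> /andP[a0 a1].
have d1 (y : R) : is_derive y 1 (fun y : R => expR y * sin y) (expR y * (sin y + cos y)).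
  by apply: is_derive_eq; rewrite /GRing.scale/=; ring.
have cf : {within `[0, a], continuous (fun y : R => expR y * sin y)}.
  apply: continuous_subspaceT => y.
  by have [/derivable1_diffP/differentiable_continuous] := d1 y.
have [c cI] := MVT a0 (fun y _ => d1 y) cf.
move: cI; rewrite in_itv/= => /andP[c0 ca].
rewrite sin0 mulr0 !subr0 => ->; rewrite -[ltLHS]mul1r ltr_pM2r//.
have s0 : 0 < sin c by apply: sin_gt0_pi; have := pi_gt0 R; lra.
have k0 : 0 < cos c by apply: cos_gt0_pihalf; have := pi_gt0 R; lra.
have sk : 1 < sin c + cos c.
  rewrite -(ltr_pXn2r (n := 2)) ?nnegrE//; last by lra.
  rewrite expr1n; have := cos2Dsin2 c; have := mulr_gt0 s0 k0; lra.
have : 1 < expR c by rewrite -[ltLHS]expR0 ltr_expR.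
by move=> ec; nra.
Qed.

Lemma high_diagonal (a : R) : h0 <= 0 -> 0 < a <= pi / 2 ->
  high (ystar - a%:C * Complex 1 1).
Proof.
move=> h00 /andP[a0 a1]; apply: high_ascent.
rewrite Re_exp_tail Im_exp_tail cReN cImN cReZ cImZ /= mulr1 cosN sinN opprK.
have h1 : expR a * cos a <= 1 + a by apply: cos_expR_le; rewrite (ltW a0).
have h2 : a < expR a * sin a by apply: sin_expR_gt; rewrite a0.
have ps0 : 0 < pi * sigma by rewrite mulr_gt0 ?pi_gt0.
rewrite ltr_wpDl//; first by rewrite mulr_le0//; lra.
by rewrite mulr_gt0//; lra.
Qed.

Lemma high_left_flat w : h0 <= 0 -> Im w = - (pi / 2) -> Re w <= - (pi / 2) ->
  high (ystar + w).
Proof.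
move=> h00 w0 w1; apply: high_ascent.
rewrite Re_exp_tail Im_exp_tail w0 cosN sinN cos_pihalf sin_pihalf.
have ps0 : 0 < pi * sigma by rewrite mulr_gt0 ?pi_gt0.
have pi0 := pi_gt0 R.
rewrite ltr_wpDl//; first by rewrite mulr_le0//; lra.
by rewrite mulr_gt0//; have := expR_ge1Dx (- Re w); lra.
Qed.

(** Far to the left the term exp(- w) dominates. *)
Lemma high_left w : - pi <= Im w <= 0 -> Re w <= 0 ->
  2 * tau < sigma * (expR (- Re w) - 1 + Re w - pi) ->
  high (ystar + w).
Proof.
move=> /andP[w0 w1] w2 h; rewrite /high tfun_saddle//.
have h1 : expR (- Re w) - 1 + Re w - pi <= normc (exp_tail w).
  have -> : exp_tail w = cexp (- w) - (1 - w) by rewrite /exp_tail; ring.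
  apply: le_trans (normcB_le _ _).
  rewrite normc_cexp cReN; have := le_normcD 1 (- w).
  rewrite normc1 normcN; have := normc_le_ReIm w.
  rewrite (ler0_norm w1) (ler0_norm w2); lra.
have h2 := ler_wpM2l (ltW sigma_gt0) h1.
have := normcB_le (sigma%:C * exp_tail w) (- tstar sigma).
rewrite opprK addrC normcM normc_real (gtr0_norm sigma_gt0) normcN => h3.
rewrite addrC; apply: lt_le_trans h3; lra.
Qed.

End Modulus.

(** * The path through the saddle *)

Section SteepPath.
Context {R : realType}.
Local Notation C := R[i].
Variables (sigma : R) (sigma_gt0 : 0 < sigma).
Implicit Types z w p q u : C.

Local Notation tau := (normc (tstar sigma)).
Local Notation ystar := (ystar sigma).
Local Notation h0 := (1 + sigma - sigma * ln sigma).
Local Notation x0 := (- ln sigma).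

(** What each point of the path off the saddle has to satisfy. *)
Definition safe z := [/\ star_regular sigma z, 0 <= Im z & high sigma z].

Lemma Re_seg p q (x : R) : Re (seg p q x) = Re p + x * (Re q - Re p).
Proof. by rewrite /seg cReD cReZ cReD cReN. Qed.

Lemma Im_seg p q (x : R) : Im (seg p q x) = Im p + x * (Im q - Im p).
Proof. by rewrite /seg cImD cImZ cImD cImN. Qed.

Lemma seg_shift z p q (x : R) : seg (z + p) (z + q) x = z + seg p q x.
Proof. by rewrite /seg; ring. Qed.

Lemma seg_ray (a b : R) u (x : R) :
  seg (a%:C * u) (b%:C * u) x = (a + x * (b - a))%:C * u.
Proof. by rewrite /seg rmorphD rmorphM rmorphB; ring. Qed.

Lemma seg_rev p q (x : R) : seg p q x = seg q p (1 - x).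
Proof. by rewrite /seg rmorphB rmorph1; ring. Qed.

Lemma convex_between (a b x : R) : a <= b -> x \in `[0, 1] ->
  a <= a + x * (b - a) <= b /\ a <= b + x * (a - b) <= b.
Proof.
move=> ab; rewrite in_itv/= => /andP[x0 x1].
by split; apply/andP; split; nra.
Qed.

Variable d : C.
Hypothesis d2 : d ^+ 2 = tstar sigma.
Hypotheses (Re_d : 0 < Re d) (Im_d : 0 < Im d).

Let d_neq0 : d != 0.
Proof. by apply/eqP => d0; move: Re_d; rewrite d0 ltxx. Qed.

(** The directions u at the saddle within an angle of pi/4 of the steepest one, d:
    along all of them |tfun| grows quadratically. *)
Definition ascent_dir u := 0 < Re (u / d) /\ 0 < Re ((u / d) ^+ 2).

Lemma ascent_dirP u : 0 < Re u -> 0 <= Im u ->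
  0 < Re (u ^+ 2) * h0 + Im (u ^+ 2) * (pi * sigma) -> ascent_dir u.
Proof.
move=> u1 u2 h; split.
  rewrite cReM cReV cImV -normc_sqr mulrN opprK !mulrA -mulrDl divr_gt0//.
    by rewrite ltr_pwDl ?mulr_gt0// mulr_ge0// ltW.
  by rewrite exprn_gt0// normc_gt0.
rewrite expr_div_n d2 cReM cReV cImV -normc_sqr mulrN opprK !mulrA -mulrDl.
apply: divr_gt0; first by move: h; rewrite mulrA.
by rewrite exprn_gt0 // normc_gt0 tstar_neq0.
Qed.

(** The points of the segment are e d ((1 - x) om + x) with om = u / d, and the real
    part of the square of this combination is bounded below because Re om and
    Re om^2 are positive. *)
Lemma ascent_dir_safe u : ascent_dir u -> exists r0 : R, 0 < r0 /\
  forall e : R, 0 < `|e| <= r0 -> forall x : R, x \in `[0, 1] ->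
    safe (ystar + seg (e%:C * u) (e%:C * d) x).
Proof.
move=> [u1 u2]; set om := u / d in u1 u2.
(* x^2 + (1 - x)^2 k >= k / 2 for k <= 1. *)
pose c := Num.min 1 (Re (om ^+ 2)) / 2.
have c0 : 0 < c by rewrite divr_gt0// lt_min ltr01.
pose U := 1 + normc om.
have U0 : 0 <= U by rewrite addr_ge0 ?normc_ge0.
have [r1 [r10 H]] := local_lower sigma_gt0 d2 U0 c0.
have [delta [delta0 G]] := star_regular_disc sigma_gt0.
have dU0 : 0 < normc d * U + 1 by rewrite ltr_wpDl// mulr_ge0 ?normc_ge0.
exists (Num.min r1 (delta / (normc d * U + 1))); split.
  by rewrite lt_min r10 divr_gt0.
move=> e /andP[e0]; rewrite le_min => /andP[e1 e2] x x01.
set v := x%:C + (1 - x)%:C * om.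
have wE : seg (e%:C * u) (e%:C * d) x = d * (e%:C * v).
  rewrite /seg /v /om rmorphB rmorph1; field.
  exact: d_neq0.
have [xx0 xx1] : 0 <= x /\ x <= 1 by move: x01; rewrite in_itv/= => /andP[].
have vU : normc v <= U.
  apply: le_trans (le_normcD _ _) _; rewrite normcM !normc_real.
  rewrite (ger0_norm xx0) ger0_norm ?subr_ge0// lerD//.
  by rewrite ler_piMl ?normc_ge0//; lra.
have vc : c <= Re (v ^+ 2).
  have vE : v ^+ 2 = (x ^+ 2)%:C + ((2 * x * (1 - x))%:C * om +
      ((1 - x) ^+ 2)%:C * om ^+ 2).
    rewrite /v rmorphXn (rmorphM _ (2 * x)) (rmorphM _ 2) rmorph_nat.
    by rewrite (rmorphXn _ 2 (1 - x)); ring.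
  rewrite vE !cReD !cReZ /=.
  have h1 : 0 <= 2 * x * (1 - x) * Re om.
    by rewrite !mulr_ge0// ?subr_ge0// ltW.
  pose k := Num.min 1 (Re (om ^+ 2)).
  have k1 : k <= 1 by rewrite /k ge_min lexx.
  have k2 : k <= Re (om ^+ 2) by rewrite /k ge_min lexx orbT.
  have k0 : 0 < k by rewrite /k lt_min ltr01.
  have h2 := ler_wpM2l (sqr_ge0 (1 - x)) k2.
  have h3 := ler_wpM2l (sqr_ge0 x) k1.
  have h4 : 0 <= k * (2 * x - 1) ^+ 2 by rewrite mulr_ge0 ?sqr_ge0// ltW.
  rewrite /c -/k; lra.
rewrite wE.
have wd : normc (d * (e%:C * v)) <= delta.
  rewrite !normcM normc_real; move: e2; rewrite ler_pdivlMr// => e2.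
  apply: le_trans e2; rewrite mulrCA ler_wpM2l//.
  have := ler_wpM2l (normc_ge0 d) vU; lra.
have [g1 g2] := G _ wd; split=> //; first exact: ltW.
have h := H e v e1 vU vc.
rewrite /high -[ltLHS]mul1r -ltr_pdivlMr; last by rewrite normc_gt0 tstar_neq0.
rewrite -normcV -normcM; apply: lt_le_trans (ler_Re_normc _).
apply: lt_le_trans (ler_norm _); apply: lt_le_trans h.
rewrite ltrDl; apply: mulr_gt0; first by rewrite divr_gt0// mulr_gt0.
by rewrite -[e ^+ 2]real_normK ?num_real// exprn_gt0.
Qed.

(** At the saddle itself |tfun| = tau, so that only the first two conditions of
    [safe] hold along this segment. *)
Lemma saddle_segment : exists r0 : R, 0 < r0 /\ forall e : R, 0 < e <= r0 ->
  onseg (fun z => star_regular sigma z /\ 0 <= Im z)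
    (ystar + d * e%:C) (ystar - d * e%:C).
Proof.
have [delta [delta0 G]] := star_regular_disc sigma_gt0.
have nd : 0 < normc d by rewrite normc_gt0.
exists (delta / normc d); split; first by rewrite divr_gt0.
move=> e /andP[e0]; rewrite ler_pdivlMr// => e1 x x01.
have -> : seg (ystar + d * e%:C) (ystar - d * e%:C) x = ystar + (e * (1 - 2 * x))%:C * d.
  by rewrite /seg rmorphM rmorphB rmorphM rmorph1 rmorph_nat; ring.
have [|g1 g2] := G ((e * (1 - 2 * x))%:C * d).
  apply: le_trans e1; rewrite normcM normc_real ler_wpM2r ?normc_ge0//.
  move: x01; rewrite in_itv/= => /andP[y0 y1].
  rewrite normrM gtr0_norm// ler_piMr ?(ltW e0)//.
  by rewrite ler_norml; apply/andP; split; lra.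
by split=> //; exact: ltW.
Qed.

Let pi0 : 0 < pi :> R. Proof. exact: pi_gt0. Qed.

Let strip_safe w : - pi < Im w <= 0 -> high sigma (ystar + w) -> safe (ystar + w).
Proof.
move=> /andP[w0 w1] h; split=> //; last by rewrite cImD/=; lra.
by apply: star_regular_strip => //; rewrite cImD/=; lra.
Qed.

Let axis_safe w : Im w = - pi -> Re w != - x0 -> high sigma (ystar + w) -> safe (ystar + w).
Proof.
move=> w0 w1 h; have i0 : Im (ystar + w) = 0 by rewrite cImD w0 /= subrr.
split=> //; last by rewrite i0.
apply: star_regular_real => //; rewrite cReD/=.
by apply: contra w1 => /eqP; rewrite addrC => /eqP; rewrite addr_eq0.
Qed.

Let right_safe w : x0 <= 0 -> 0 <= Re w -> - pi < Im w -> high sigma (ystar + w) ->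
  safe (ystar + w).
Proof.
move=> x00 w0 w1 h.
have i0 : 0 < Im (ystar + w) by rewrite cImD/=; lra.
split=> //; last exact: ltW.
by apply: star_regular_right => //; rewrite cReD/=; lra.
Qed.

(** A path from the positive real axis to the saddle that arrives along the ray of
    direction u; every e in (0, B] is allowed as end parameter on it. *)
Definition right_branch u (B : R) p (ps : seq C) :=
  [/\ 0 < B, ascent_dir u, Im p = 0 /\ 0 < Re p,
      allseg (onseg safe) p ps /\ last p ps = ystar + B%:C * u &
      forall e : R, 0 < e <= B -> onseg safe (ystar + B%:C * u) (ystar + e%:C * u)].

(** The counterpart of [right_branch], which leaves the saddle in the direction - u
    towards the negative real axis. *)
Definition left_branch u (B : R) (ps : seq C) :=
  let q := last (ystar - B%:C * u) ps in
  [/\ 0 < B, ascent_dir u, Im q = 0 /\ Re q < 0,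
      allseg (onseg safe) (ystar - B%:C * u) ps &
      forall e : R, 0 < e <= B -> onseg safe (ystar - e%:C * u) (ystar - B%:C * u)].

Lemma far_right : exists M : R, [/\ 1 <= M, 0 < x0 + M & tau < h0 + sigma * (M - 2)].
Proof.
have [q [q0 h1]] : exists q : R, 0 <= q /\ sigma * q = tau + `|h0|.
  exists ((tau + `|h0|) / sigma); split; last by field; rewrite gt_eqF.
  by rewrite divr_ge0 ?(ltW sigma_gt0)// addr_ge0 ?normc_ge0.
have a0 := normr_ge0 x0; have a1 := ler_norm (- x0); have b1 := ler_norm (- h0).
rewrite normrN in a1; rewrite normrN in b1.
have h2 : 0 <= sigma * `|x0| by rewrite mulr_ge0// ltW.
by exists (1 + `|x0| + (3 + q)); split; have := sigma_gt0; lra.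
Qed.

Lemma far_left : exists M : R, [/\ 2 <= M, x0 - M < 0, pi / 2 <= M &
  2 * tau < sigma * (expR M - 1 - M - pi)].
Proof.
have [q [q0 h1]] : exists q : R, 0 <= q /\ sigma * q = 2 * tau.
  exists (2 * tau / sigma); split; last by field; rewrite gt_eqF.
  by rewrite divr_ge0 ?(ltW sigma_gt0)// mulr_ge0 ?normc_ge0.
have a0 := normr_ge0 x0; have a1 := ler_norm x0.
have [M ME] : exists M : R, M = 5 + pi + `|x0| + q by eexists.
have pi_pos := pi_gt0 R.
have M4 : 4 < M by rewrite ME; lra.
exists M; split; [lra|lra|lra|].
have e1 : 1 + M + M < expR M.
  have {3}-> : M = M / 2 + M / 2 by field.
  rewrite expRD; have := expR_ge1Dx (M / 2); set E := expR _ => hE.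
  have : (1 + M / 2) * (1 + M / 2) <= E * E by apply: ler_pM => //; lra.
  have : 0 < (M - 4) * M by rewrite mulr_gt0//; lra.
  lra.
by rewrite -h1 ltr_pM2l//; lra.
Qed.

Let column_safe w : - pi <= Im w <= 0 -> Re w != - x0 -> high sigma (ystar + w) ->
  safe (ystar + w).
Proof.
move=> /andP[]; rewrite le_eqVlt => /predU1P[w0 _|w0 w1] wx h.
  exact: axis_safe (esym w0) wx h.
by apply: strip_safe => //; rewrite w0.
Qed.

Lemma right_branch_pos : 0 < h0 -> exists u B p ps, right_branch u B p ps.
Proof.
move=> h00; have [M [M1 M2 M3]] := far_right.
exists 1, M, (ystar + Complex M (- pi)), [:: ystar + M%:C * 1]; split.
- lra.
- apply: ascent_dirP; rewrite ?expr1n//= ?mul0r ?mul1r ?addr0//.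
- by split; rewrite ?cImD ?cReD/= ?subrr.
- split=> //=; split=> // x x01; rewrite seg_shift.
  set w := seg _ _ x.
  have wR : Re w = M by rewrite Re_seg /= mulr1 mul0r subr0 subrr mulr0 addr0.
  have wI : Im w = - pi + x * pi by rewrite Im_seg /= mulr0 mul0r addr0 add0r opprK.
  apply: column_safe.
  + rewrite wI; move: x01; rewrite in_itv/= => /andP[y0 y1].
    have := mulr_ge0 y0 (ltW pi0); have := ler_wpM2r (ltW pi0) y1.
    by move=> h1 h2; apply/andP; split; lra.
  + by rewrite wR gt_eqF//; lra.
  + by apply: high_right; rewrite ?wR//; lra.
- move=> e /andP[e0 eM] x x01; rewrite seg_shift seg_ray.
  have [_ /andP[b1 b2]] := convex_between eM x01.
  set b := M + _ in b1 b2 *.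
  have bI : Im (b%:C * 1 : C) = 0 by rewrite cImZ mulr0.
  have bR : Re (b%:C * 1 : C) = b by rewrite cReZ mulr1.
  apply: strip_safe; first by rewrite bI lexx oppr_lt0 pi0.
  by apply: high_horizontal => //; rewrite bR gt_eqF//; lra.
Qed.

Lemma left_branch_pos : 0 < h0 -> exists u B ps, left_branch u B ps.
Proof.
move=> h00; have [M [M1 M2 M3 M4]] := far_left.
exists 1, M, [:: ystar + Complex (- M) (- pi)]; split.
- lra.
- apply: ascent_dirP; rewrite ?expr1n//= ?mul0r ?mul1r ?addr0//.
- by split; rewrite /= ?subrr.
- split=> // x x01; rewrite seg_shift.
  set w := seg _ _ x.
  have wR : Re w = - M.
    by rewrite Re_seg cReN cReZ /= mulr1 opprK addNr mulr0 addr0.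
  have wI : Im w = - x * pi.
    by rewrite Im_seg cImN cImZ /= mulr0 oppr0 add0r subr0 mulrN mulNr.
  have hI : - pi <= Im w <= 0.
    rewrite wI; move: x01; rewrite in_itv/= => /andP[y0 y1].
    have := mulr_ge0 y0 (ltW pi0); have := ler_wpM2r (ltW pi0) y1.
    by move=> h1 h2; apply/andP; split; lra.
  apply: column_safe => //; first by rewrite wR lt_eqF//; lra.
  by apply: high_left => //; rewrite wR ?opprK//; lra.
- move=> e /andP[e0 eM] x x01; rewrite seg_shift -!mulNr -!rmorphN seg_ray.
  have [_ /andP[b1 b2]] := convex_between eM x01.
  set b := - e + _.
  have b3 : b < 0.
    have [/andP[b3 b4] _] := convex_between eM x01.
    by rewrite /b; lra.
  have bI : Im (b%:C * 1 : C) = 0 by rewrite cImZ mulr0.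
  have bR : Re (b%:C * 1 : C) = b by rewrite cReZ mulr1.
  apply: strip_safe; first by rewrite bI lexx oppr_lt0 pi0.
  by apply: high_horizontal => //; rewrite bR lt_eqF.
Qed.

Lemma saddle_left_of_axis : h0 <= 0 -> x0 <= 0.
Proof.
move=> h; rewrite leNgt; apply/negP => l0.
have : 0 < sigma * x0 by rewrite mulr_gt0.
have := sigma_gt0; lra.
Qed.

(** The slanted ray of [high_slanted] is followed up to height B, where the imaginary
    part alone makes |tfun| > tau; from there the path runs right and then down. *)
Lemma right_branch_neg : h0 <= 0 -> exists u B p ps, right_branch u B p ps.
Proof.
move=> h00; have x00 := saddle_left_of_axis h00.
have [M [M1 M2 M3]] := far_right.
have [B [B1 BE]] : exists B : R, 1 <= B /\ tau < pi * sigma + sigma * (B - 1).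
  exists (1 + tau / sigma); split.
    by rewrite lerDl divr_ge0 ?normc_ge0 ?(ltW sigma_gt0).
  have -> : sigma * (1 + tau / sigma - 1) = tau by field; rewrite gt_eqF.
  by rewrite ltrDr mulr_gt0.
have ps0 : 0 < pi * sigma by rewrite mulr_gt0.
have [k [k0 k1 k2 kB]] : exists k : R,
    [/\ 0 < k, k < 1, 2 * k * (- h0) < pi * sigma & k * B <= 1].
  (* The reciprocal sum meets all three smallness conditions at once. *)
  pose k := (B + 1 + 2 * (- h0) / (pi * sigma))^-1.
  have q0 : 0 <= 2 * (- h0) / (pi * sigma).
    by rewrite divr_ge0 ?(ltW ps0)// mulr_ge0// oppr_ge0.
  have D0 : 0 < B + 1 + 2 * (- h0) / (pi * sigma) by lra.
  have kD : k * (B + 1 + 2 * (- h0) / (pi * sigma)) = 1 by rewrite mulVf ?gt_eqF.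
  have k0 : 0 < k by rewrite invr_gt0.
  have kB0 : 0 < k * B by rewrite mulr_gt0//; lra.
  have kq0 : 0 <= k * (2 * (- h0) / (pi * sigma)) by rewrite mulr_ge0// ltW.
  exists k; split=> //.
  - have : k * 1 <= k * B by rewrite ler_pM2l.
    lra.
  - have -> : 2 * k * (- h0) = k * (2 * (- h0) / (pi * sigma)) * (pi * sigma).
      by rewrite -[RHS]mulrA divfK ?gt_eqF//; ring.
    by rewrite -[ltRHS]mul1r ltr_pM2r//; lra.
  - lra.
pose u : C := Complex k 1.
have uI (b : R) : Im (b%:C * u) = b by rewrite cImZ mulr1.
have uR (b : R) : Re (b%:C * u) = b * k by rewrite cReZ.
exists u, B, (ystar + Complex M (- pi)), [:: ystar + Complex M B; ystar + B%:C * u].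
split.
- lra.
- apply: ascent_dirP => //=; rewrite /u ?expr2 ?cReM ?cImM/=. 
  have : 0 <= (k * k - 1 * 1) * h0.
    have kk : k * k <= 1 * 1 by apply: ler_pM; rewrite ?(ltW k0) ?(ltW k1).
    by rewrite mulr_le0//; lra.
  by have := mulr_gt0 k0 ps0; lra.
- by split; rewrite ?cImD ?cReD/= ?subrr.
- split=> //=; split; last split=> //.
    move=> x x01; rewrite seg_shift; set w := seg _ _ x.
    have wR : Re w = M by rewrite Re_seg /= subrr mulr0 addr0.
    have wI : Im w = - pi + x * (B + pi) by rewrite Im_seg /= opprK.
    have hw : high sigma (ystar + w) by apply: high_right; rewrite ?wR//; lra.
    have /= [hx|hx] := lerP (Im w) (- pi).
      apply: column_safe => //; last by rewrite wR gt_eqF//; lra.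
      rewrite (le_trans hx) ?oppr_le0 ?(ltW pi0)// andbT wI.
      move: x01; rewrite in_itv/= => /andP[y0 y1].
      by rewrite lerDl mulr_ge0//; have := pi0; lra.
    by apply: right_safe => //; rewrite wR; lra.
  move=> x x01; rewrite seg_shift; set w := seg _ _ x.
  have wI : Im w = B by rewrite Im_seg uI /= subrr mulr0 addr0.
  have wR : 0 <= Re w.
    rewrite Re_seg uR /=; have kB' : B * k <= M by rewrite mulrC; lra.
    have [_ /andP[b1 b2]] := convex_between kB' x01.
    by apply: le_trans b1; rewrite mulr_ge0 ?(ltW k0)//; lra.
  apply: right_safe => //; first by rewrite wI; have := pi0; lra.
  by apply: high_top => //; rewrite wI.
- move=> e /andP[e0 eB] x x01; rewrite seg_shift seg_ray.
  have [_ /andP[b1 b2]] := convex_between eB x01.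
  set b := B + _ in b1 b2 *.
  have b0 : 0 < b by lra.
  apply: right_safe => //.
  + by rewrite uR mulr_ge0// ltW.
  + by rewrite uI; have := pi0; lra.
  + apply: high_slanted => //; apply: le_trans kB; rewrite ler_pM2l//.
Qed.

(** From the saddle down the diagonal to imaginary part pi / 2, then left, then down. *)
Lemma left_branch_neg : h0 <= 0 -> exists u B ps, left_branch u B ps.
Proof.
move=> h00; have [M [M1 M2 M3 M4]] := far_left.
have pi20 : 0 < pi / 2 :> R by rewrite divr_gt0.
have ps0 : 0 < pi * sigma by rewrite mulr_gt0.
pose u : C := Complex 1 1.
have uI (b : R) : Im (b%:C * u) = b by rewrite cImZ mulr1.
have uR (b : R) : Re (b%:C * u) = b by rewrite cReZ mulr1.
exists u, (pi / 2), [:: ystar + Complex (- M) (- (pi / 2));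
  ystar + Complex (- M) (- pi)]; split.
- by [].
- apply: ascent_dirP => //=; rewrite /u ?expr2 ?cReM ?cImM/=; lra.
- by split; rewrite /= ?subrr.
- split; last split=> //.
    move=> x x01; rewrite seg_shift; set w := seg _ _ x.
    have wI : Im w = - (pi / 2).
      by rewrite Im_seg cImN uI /= opprK addNr mulr0 addr0.
    have wR : Re w <= - (pi / 2).
      rewrite Re_seg cReN uR /=.
      have M3' : - M <= - (pi / 2) by rewrite lerN2.
      by have [_ /andP[]] := convex_between M3' x01.
    apply: strip_safe; first by rewrite wI; lra.
    exact: high_left_flat.
  move=> x x01; rewrite seg_shift; set w := seg _ _ x.
  have wR : Re w = - M by rewrite Re_seg /= subrr mulr0 addr0.
  have wI : Im w = - (pi / 2) + x * (- pi - - (pi / 2)) by rewrite Im_seg.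
  have pp : - pi <= - (pi / 2) :> R by lra.
  have [_ /andP[i1 i2]] := convex_between pp x01.
  have hI : - pi <= Im w <= 0 by rewrite wI i1/=; apply: le_trans i2 _; lra.
  apply: column_safe => //; first by rewrite wR lt_eqF//; lra.
  by apply: high_left => //; rewrite wR ?opprK//; lra.
- move=> e /andP[e0 eM] x x01; rewrite seg_shift -!mulNr -!rmorphN seg_ray.
  have [/andP[b1 b2] _] := convex_between eM x01.
  set a := e + _ in b1 b2.
  have -> : - e + x * (- (pi / 2) - - e) = - a by rewrite /a; ring.
  have a0 : 0 < a by lra.
  apply: strip_safe; first by rewrite uI; have := pi0; lra.
  by rewrite rmorphN mulNr; apply: high_diagonal => //; rewrite a0.
Qed.

Lemma allseg_safe p ps : allseg (onseg safe) p ps ->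
  [/\ allseg (sweep (regular sigma)) p ps, allseg (onseg (fun z => 0 <= Im z)) p ps
    & allseg (onseg (high sigma)) p ps].
Proof.
move=> h; split; apply: allsegW h => a b ab; last by move=> x /ab[].
  by apply: star_regular_sweep => x /ab[].
by move=> x /ab[].
Qed.

(** The two branches are cut at distance e from the saddle and joined to the ends
    of the segment of direction d by short segments within the cone of ascent. *)
Lemma steep_path r0 : 0 < r0 -> exists (e : R) p ps qs, [/\ 0 < e <= r0,
  last p ps = ystar + d * e%:C,
  let path := ps ++ (ystar - d * e%:C) :: qs in
  [/\ allseg (sweep (regular sigma)) p path,
      allseg (onseg (fun z => 0 <= Im z)) p path,
      Im p = 0 /\ 0 < Re p & Im (last p path) = 0 /\ Re (last p path) < 0],
  allseg (onseg (high sigma)) p ps &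
  allseg (onseg (high sigma)) (ystar - d * e%:C) qs].
Proof.
move=> r00.
have [u [B [p [ps [B0 au pr [sps lps] hps]]]]] :
    exists u B p ps, right_branch u B p ps.
  by have [h|h] := ltP 0 h0; [exact: right_branch_pos|exact: right_branch_neg].
have [v [A [qs [A0 av ql sqs hqs]]]] : exists v A qs, left_branch v A qs.
  by have [h|h] := ltP 0 h0; [exact: left_branch_pos|exact: left_branch_neg].
have [r1 [r10 H1]] := ascent_dir_safe au.
have [r2 [r20 H2]] := ascent_dir_safe av.
have [r3 [r30 H3]] := saddle_segment.
have [e [e0 e_le]] : exists e : R, 0 < e /\
    [/\ e <= r0, e <= r1, e <= r2, e <= r3 & e <= B /\ e <= A].
  exists (Num.min r0 (Num.min r1 (Num.min r2 (Num.min r3 (Num.min B A))))); split.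
    by rewrite !lt_min r00 r10 r20 r30 B0 A0.
  by split; rewrite ?ge_min ?lexx ?orbT//; split; rewrite !ge_min lexx ?orbT.
have [er0 er1 er2 er3 [eB eA]] := e_le.
pose ps' := ps ++ [:: ystar + e%:C * u; ystar + d * e%:C].
pose qs' := [:: ystar - e%:C * v, ystar - A%:C * v & qs].
have lps' : last p ps' = ystar + d * e%:C by rewrite /ps' last_cat.
have safe_ps : allseg (onseg safe) p ps'.
  apply/allseg_cat; split=> //=; rewrite lps; split; first by apply: hps; rewrite e0.
  split=> // x x01; rewrite (mulrC d) seg_shift; apply: H1 => //.
  by rewrite gtr0_norm// e0.
have safe_qs : allseg (onseg safe) (ystar - d * e%:C) qs'.
  rewrite /qs'/=; split; last by split=> //; apply: hqs; rewrite e0.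
  move=> x x01; rewrite (mulrC d) seg_shift -!mulNr -!rmorphN seg_rev.
  apply: H2; first by rewrite normrN gtr0_norm// e0.
  by move: x01; rewrite !in_itv/= => /andP[y0 y1]; apply/andP; split; lra.
exists e, p, ps', qs'.
have [sw1 up1 hi1] := allseg_safe safe_ps.
have [sw2 up2 hi2] := allseg_safe safe_qs.
have h3 := H3 e; rewrite e0 er3 in h3; have {}h3 := h3 isT.
split=> //; first by rewrite e0.
split.
- apply/allseg_cat; split=> //=; rewrite lps'; split=> //.
  by apply: star_regular_sweep => x /h3[].
- by apply/allseg_cat; split=> //=; rewrite lps'; split=> // x /h3[].
- exact: pr.
- by rewrite last_cat.
Qed.

End SteepPath.

(** * The asymptotic formula *)

Section Polar.
Context {R : realType}.
Local Notation C := R[i].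

Definition cis (phi : R) : C := Complex (cos phi) (sin phi).

Lemma cisD (a b : R) : cis (a + b) = cis a * cis b.
Proof. by apply: complexP; rewrite ?cReM ?cImM/= ?cosD ?sinD; ring. Qed.

Lemma cis0 : cis 0 = 1.
Proof. by rewrite /cis cos0 sin0. Qed.

Lemma cisX (a : R) n : cis a ^+ n = cis (n%:R * a).
Proof.
elim: n => [|n IH]; first by rewrite mul0r cis0.
by rewrite exprS IH -cisD -natr1; congr cis; ring.
Qed.

Lemma cisV (a : R) : (cis a)^-1 = cis (- a).
Proof.
have h : cis a * cis (- a) = 1 by rewrite -cisD subrr cis0.
have a0 : cis a != 0.
  by apply/eqP => a0; move/eqP: h; rewrite a0 mul0r eq_sym oner_eq0.
by rewrite -[RHS]mul1r -(mulVf a0) -mulrA h mulr1.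
Qed.

Lemma cargE (z : C) : z != 0 -> z = (normc z)%:C * cis (carg z).
Proof.
move=> z0; have [_ {1}->] := cargP z0.
by apply: complexP; rewrite ?cReZ ?cImZ.
Qed.

End Polar.

Lemma powR_three_half {R : realType} (a : R) : 0 < a ->
  a `^ (3 / 2) = a * Num.sqrt a.
Proof.
move=> a0; have -> : 3 / 2 = 1 + 2^-1 :> R by field.
rewrite powRD; last by rewrite (gt_eqF a0) implybT.
by rewrite powRr1 ?(ltW a0)// powR12_sqrt// ltW.
Qed.

Section Asymptotics.
Context {R : realType}.
Local Notation C := R[i].
Variables (sigma : R) (sigma_gt0 : 0 < sigma).

Local Notation tau := (normc (tstar sigma)).
Local Notation theta := (carg (tstar sigma)).

Let ts0 := tstar_neq0 sigma_gt0.
Let tau_gt0 : 0 < tau. Proof. by rewrite normc_gt0. Qed.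

(** The square root of [tstar] in the open first quadrant. *)
Definition dstar : C := (Num.sqrt tau)%:C * cis (theta / 2).

Lemma dstar_sqr : dstar ^+ 2 = tstar sigma.
Proof.
rewrite [RHS](cargE ts0) /dstar exprMn -rmorphXn sqr_sqrtr ?(ltW tau_gt0)//.
by rewrite cisX; congr (_ * cis _); field.
Qed.

(** The real part is nonnegative, and twice the product of both parts is
    Im tstar > 0. *)
Lemma dstar_quadrant : 0 < Re dstar /\ 0 < Im dstar.
Proof.
have [/andP[t1 t2] _] := cargP ts0.
have h : Im (dstar ^+ 2) = pi * sigma by rewrite dstar_sqr.
have hp : 0 < Im (dstar ^+ 2) by rewrite h mulr_gt0 ?pi_gt0.
move: hp; rewrite expr2 cImM => hp.
have r0 : 0 <= Re dstar.
  rewrite cReZ mulr_ge0 ?sqrtr_ge0//= cos_ge0_pihalf//.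
  by apply/andP; split; lra.
have r1 : 0 < Re dstar.
  rewrite lt_neqAle r0 andbT eq_sym; apply/eqP => r00.
  by move: hp; rewrite r00 mul0r mulr0 addr0 ltxx.
split=> //; have : 0 < Re dstar * (2 * Im dstar) by lra.
by rewrite pmulr_rgt0// pmulr_rgt0.
Qed.

Lemma saddle_constE m : saddle_const sigma dstar m =
  Num.sqrt (2 * pi / sigma) * (Num.sqrt tau * sin ((m%:R - 1 / 2) * theta)).
Proof.
rewrite /saddle_const; congr (_ * _).
have -> : tau%:C / tstar sigma = cis (- theta).
  rewrite {2}(cargE ts0) invfM cisV mulrA mulfV ?mul1r//.
  by rewrite -normc_gt0 normc_real gtr0_norm.
rewrite cisX /dstar -mulrA -cisD cImN cImZ /= -mulrN -sinN.
by congr (_ * sin _); field.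
Qed.

Lemma off_saddle_path p ps : allseg (onseg (high sigma)) p ps ->
  exists K : R, forall m : nat, (0 < m)%N ->
  `|Num.sqrt m%:R * tau ^+ m * impath (fun z => (tfun sigma z)^-1 ^+ m) p ps|
    <= K / Num.sqrt m%:R.
Proof.
elim: ps p => [|q ps IH] p /=.
  by move=> _; exists 0 => m _; rewrite mulr0 normr0 mul0r.
move=> [h1 /IH[K2 hK2]]; have [K1 hK1] := off_saddle sigma_gt0 h1.
exists (K1 + K2) => m m0; rewrite mulrDr [leRHS]mulrDl.
by apply: le_trans (ler_normD _ _) _; rewrite lerD ?hK1 ?hK2.
Qed.

(** The integral splits at the saddle segment, which alone contributes to the limit. *)
Lemma coef_c_asym : exists (K : R) (m0 : nat), forall m : nat, (m0 <= m)%N ->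
  `|m%:R * Num.sqrt m%:R * tau ^+ m * coef_c sigma m - saddle_const sigma dstar m / pi|
    <= K / Num.sqrt m%:R.
Proof.
have [d1 d2] := dstar_quadrant.
have [r0 [r00 hr0]] := saddle_asym sigma_gt0 dstar_sqr.
have [e [p [ps [qs]]]] := steep_path sigma_gt0 dstar_sqr d1 d2 r00.
move=> [e0 lps [sw up [p1 p2] [l1 l2]] hps hqs].
have [K1 [m1 h1]] := hr0 e e0.
have [K2 h2] := off_saddle_path hps.
have [K3 h3] := off_saddle_path hqs.
exists ((K1 + K2 + K3) / pi), (maxn 1 m1) => m; rewrite geq_max => /andP[m0 mm1].
have pi0 := pi_gt0 R; have m0R : 0 < m%:R :> R by rewrite ltr0n.
rewrite (coef_cE sigma_gt0 sw up p1 p2 l1 l2 m0) impath_cat lps /=.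
set I1 := impath _ p ps; set I2 := imint _ _ _; set I3 := impath _ _ qs.
set S := saddle_const _ _ _; set sm := Num.sqrt _.
have -> : m%:R * sm * tau ^+ m * ((pi * m%:R)^-1 * (I1 + (I2 + I3))) - S / pi =
    ((sm * tau ^+ m * I2 - S) + sm * tau ^+ m * I1 + sm * tau ^+ m * I3) / pi.
  by move: (pi : R) pi0 => P P0; field; rewrite !gt_eqF.
rewrite normrM normfV (gtr0_norm pi0) [leRHS]mulrAC ler_wpM2r ?invr_ge0 ?(ltW pi0)//.
apply: le_trans (ler_normD _ _) _; rewrite [leRHS]mulrDl lerD ?h3//.
by apply: le_trans (ler_normD _ _) _; rewrite [leRHS]mulrDl lerD ?h2 ?h1.
Qed.

Lemma main_termE m : (0 < m)%N ->
  Num.sqrt (2 / (pi * sigma)) * (sin ((m%:R - 1 / 2) * theta) /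
    (tau `^ (m%:R - 1 / 2) * m%:R `^ (3 / 2))) =
  saddle_const sigma dstar m / pi / (m%:R * Num.sqrt m%:R * tau ^+ m).
Proof.
move=> m0; have m0R : 0 < m%:R :> R by rewrite ltr0n.
rewrite saddle_constE.
have pi0 := pi_gt0 R.
have -> : 2 / (pi * sigma) = 2 * pi / sigma * (pi^-1) ^+ 2.
  by move: (pi : R) pi0 => P P0; field; rewrite !gt_eqF.
rewrite sqrtrM ?divr_ge0 ?mulr_ge0 ?(ltW pi0) ?(ltW sigma_gt0)//.
rewrite sqrtr_sqr gtr0_norm ?invr_gt0//.
have half : 1 / 2 = 2^-1 :> R by rewrite mul1r.
have -> : tau `^ (m%:R - 1 / 2) = tau ^+ m / Num.sqrt tau.
  rewrite powRD; last by rewrite (gt_eqF tau_gt0) implybT.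
  by rewrite powR_mulrn ?(ltW tau_gt0)// powRN half powR12_sqrt// ltW.
rewrite (powR_three_half m0R).
have sm0 : 0 < Num.sqrt m%:R :> R by rewrite sqrtr_gt0.
have st0 : 0 < Num.sqrt tau by rewrite sqrtr_gt0.
have tm0 : 0 < tau ^+ m by rewrite exprn_gt0.
move: (pi : R) pi0 => P P0; move: (sin _) (Num.sqrt (2 * P / sigma)) => s q.
by field; rewrite !gt_eqF.
Qed.

End Asymptotics.

Theorem mainTheorem9 (R : realType) (sigma : R) (hsigma : 0 < sigma) :
  let z : R[i] := Complex (1 + sigma - sigma * ln sigma) (pi * sigma) in
  let tau := normc z in
  let theta := carg z in
  (fun m : nat => coef_c sigma m) =
  (fun m : nat =>
     Num.sqrt (2 / (pi * sigma)) *
       (sin ((m%:R - 1 / 2) * theta) /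
          (tau `^ (m%:R - 1 / 2) * m%:R `^ (3 / 2))))
  +o_\oo (fun m : nat => 1 / (m%:R `^ (3 / 2) * tau ^+ m)).
Proof.
move=> z tau theta; apply/eqaddoP => eps eps_gt0.
have [K [m0 hK]] := coef_c_asym hsigma.
have tau_gt0 : 0 < tau by rewrite normc_gt0; exact: tstar_neq0.
near=> m.
have m_gt0 : (0 < m)%N by near: m; exact: nbhs_infty_gt.
have m0R : 0 < m%:R :> R by rewrite ltr0n.
have sm0 : 0 < Num.sqrt m%:R :> R by rewrite sqrtr_gt0.
have tm0 : 0 < tau ^+ m by rewrite exprn_gt0.
pose D := m%:R * Num.sqrt m%:R * tau ^+ m.
have D0 : 0 < D by rewrite !mulr_gt0.
suff hX : `|coef_c sigma m - saddle_const sigma (dstar sigma) m / pi / D|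
    <= eps * `|1 / D|.
  rewrite -(main_termE hsigma m_gt0) in hX.
  by rewrite /D -(powR_three_half m0R) in hX.
have -> : coef_c sigma m - saddle_const sigma (dstar sigma) m / pi / D =
    (D * coef_c sigma m - saddle_const sigma (dstar sigma) m / pi) / D.
  by rewrite mulrBl (mulrC D) mulfK ?gt_eqF//.
rewrite normrM div1r ler_wpM2r//.
have mm0 : (m0 <= m)%N by near: m; exact: nbhs_infty_ge.
apply: le_trans (hK m mm0) _; rewrite ler_pdivrMr// mulrC -ler_pdivrMr//.
have mK : (K / eps) ^+ 2 <= m%:R by near: m; exact: nbhs_infty_ger.
by apply: le_trans (ler_norm _) _; rewrite -sqrtr_sqr ler_wsqrtr.
Unshelve. all: by end_near. Qed.
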